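(* Let $N\in\mathbb{N}$, let $X_1,\dots,X_N,Y_1,\dots,Y_N$ be Polish spaces, $X=\prod_{t=1}^N X_t$, $Y=\prod_{t=1}^N Y_t$, $\mu\in\mathcal P(X)$ and $\nu\in\mathcal P(Y)$. If $\pi\in\mathrm{Cpl}_{bc}(\mu,\nu)$, then there exists a biadapted map $T:\widehat X\to\widehat Y$ such that (i) $T_\ast\widehat\mu=\widehat\nu$, and (ii) with $\widehat\pi:=(\mathrm{id},T)_\ast\widehat\mu$, one has $(\mathrm{pr}_{X\times Y})_\ast\widehat\pi=\pi$. Conversely, if $\pi\in\mathcal P(X\times Y)$ and there exists a biadapted map $T:\widehat X\to\widehat Y$ satisfying (i) and (ii), then $\pi\in\mathrm{Cpl}_{bc}(\mu,\nu)$.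
   Context: $\lambda$ is Lebesgue measure on $[0,1]$. Set $\widehat X_t:=X_t\times[0,1]$, $\widehat X:=\prod_{t=1}^N\widehat X_t$ (elements written $(x_{1:N},u_{1:N})$ with $x_t\in X_t,u_t\in[0,1]$), similarly $\widehat Y_t=Y_t\times[0,1]$, $\widehat Y=\prod_t\widehat Y_t$. $\widehat\mu:=\mu\otimes\lambda^N$ (i.e. $\int f\,d\widehat\mu=\int f(x_{1:N},u_{1:N})\,d\mu(x_{1:N})d\lambda^N(u_{1:N})$), similarly $\widehat\nu$. $\mathrm{pr}_{X\times Y}:\widehat X\times\widehat Y\to X\times Y$ forgets the $[0,1]$-coordinates. For products $A=\prod_{t=1}^N A_t$, $B=\prod_{t=1}^N B_t$ of Polish spaces, a Borel map $T=(T_1,\dots,T_N):A\to B$ ($T_t$ with values in $B_t$) is adapted if each $T_t(a)$ depends only on $(a_1,\dots,a_t)$; it is biadapted if it is bijective and both $T$ and $T^{-1}$ are adapted (for $\widehat X,\widehat Y$ the time-$t$ factors are $\widehat X_t,\widehat Y_t$). For $t<N$ let $\mathcal F^X_t$ (resp. $\mathcal F^Y_t$) be the $\sigma$-algebra on $X$ (resp. $Y$) generated by the first $t$ coordinates. $\pi\in\mathrm{Cpl}(\mu,\nu)$ with disintegration $\pi(dx,dy)=\mu(dx)\pi^x(dy)$ is causal if for all $t<N$ and $B\in\mathcal F^Y_t$ the map $x\mapsto\pi^x(B)$ is $\mathcal F^X_t$-measurable; bicausal if moreover the image of $\pi$ under $(x,y)\mapsto(y,x)$ is a causal coupling of $\nu$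 and $\mu$. $\mathrm{Cpl}_{bc}(\mu,\nu)$ is the set of bicausal couplings. *)

(* Defs.v *)
From HB Require Import structures.
From mathcomp Require Import all_boot all_order all_algebra.
From mathcomp Require Import all_classical all_reals all_analysis measurable_realfun.
Import Order.TTheory GRing.Theory Num.Theory.
Import numFieldNormedType.Exports.
Local Open Scope classical_set_scope.
Local Open Scope ring_scope.

Section defs.
Variable R : realType.

Definition polish (T : completePseudoMetricType R) : Prop :=
  hausdorff_space T /\ exists D : set T, countable D /\ dense D.

Definition borel (T : topologicalType) : set (set T) := <<s @open T >>.

Variable N : nat.

Definition cyl (X : 'I_N -> completePseudoMetricType R) : set (set (forall t, X t)) :=
  [set A | exists t : 'I_N, exists B : set (X t),
     borel (X t) B /\ A = (fun x : forall t, X t => x t) @^-1` B].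

Definition cyl_upto (X : 'I_N -> completePseudoMetricType R) (t : nat)
  : set (set (forall t, X t)) :=
  [set A | exists s : 'I_N, (s < t)%N /\ exists B : set (X s),
     borel (X s) B /\ A = (fun x : forall t, X t => x s) @^-1` B].

Definition PiM (X : 'I_N -> completePseudoMetricType R) := g_sigma_algebraType (cyl X).

Definition I01 := {x : R | (0 <= x <= 1)}.
Lemma I01_0 : (0 <= (0:R) <= 1). Proof. by rewrite lexx ler01. Qed.
Definition I01_pt : I01 := exist _ 0 I01_0.
HB.instance Definition _ := Choice.on I01.
HB.instance Definition _ := isPointed.Build I01 I01_pt.

Definition hat (X : 'I_N -> completePseudoMetricType R) :=
  ((forall t, X t) * ('I_N -> I01))%type.

Definition hcyl (X : 'I_N -> completePseudoMetricType R) : set (set (hat X)) :=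
  [set A | exists t : 'I_N,
     (exists B : set (X t), borel (X t) B /\ A = [set a : hat X | B (a.1 t)]) \/
     (exists D : set R, measurable D /\ A = [set a : hat X | D (sval (a.2 t))])].

Definition HatM (X : 'I_N -> completePseudoMetricType R) := g_sigma_algebraType (hcyl X).


Definition clamp01 (s : R) : I01 := insubd I01_pt s.

Definition upd (u : 'I_N -> I01) (k : nat) (s : R) : 'I_N -> I01 :=
  fun i => if (i == k :> nat) then clamp01 s else u i.

Fixpoint iint (k : nat) (f : ('I_N -> I01) -> \bar R) (u : 'I_N -> I01) : \bar R :=
  match k with
  | 0 => f u
  | k'.+1 => (\int[lebesgue_measure]_(s in `[0%R, 1%R]) iint k' f (upd u k' s))%E
  end.

Definition lebN (S : set ('I_N -> I01)) : \bar R :=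
  iint N (fun u => (\1_S u)%:E) (fun _ => I01_pt).

Definition hatmeasure (X : 'I_N -> completePseudoMetricType R)
  (mu : probability (PiM X) R) (A : set (hat X)) : \bar R :=
  (\int[mu]_x lebN [set u | A (x, u)])%E.

Definition coupling (X Y : 'I_N -> completePseudoMetricType R)
  (mu : probability (PiM X) R) (nu : probability (PiM Y) R)
  (pi : probability (PiM X * PiM Y)%type R) : Prop :=
  (forall A : set (PiM X), measurable A -> pi (A `*` setT) = mu A) /\
  (forall B : set (PiM Y), measurable B -> pi (setT `*` B) = nu B).

Definition causal (X Y : 'I_N -> completePseudoMetricType R)
  (mu : probability (PiM X) R) (pi : set (PiM X * PiM Y) -> \bar R) : Prop :=
  exists k : R.-pker (PiM X) ~> (PiM Y),
    (forall (A : set (PiM X)) (B : set (PiM Y)), measurable A -> measurable B ->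
        pi (A `*` B) = (\int[mu]_(x in A) k x B)%E) /\
    (forall t : nat, (0 < t < N)%N ->
       forall B : set (PiM Y), <<s cyl_upto Y t >> B ->
       forall U : set (\bar R), measurable U ->
         <<s cyl_upto X t >> ((fun x => k x B) @^-1` U)).

Definition bicausal (X Y : 'I_N -> completePseudoMetricType R)
  (mu : probability (PiM X) R) (nu : probability (PiM Y) R)
  (pi : probability (PiM X * PiM Y)%type R) : Prop :=
  coupling X Y mu nu pi /\ causal X Y mu pi /\
  causal Y X nu (fun C : set (PiM Y * PiM X) =>
               pi ((fun p : PiM X * PiM Y => (p.2, p.1)) @^-1` C)).

Definition adapted (X Y : 'I_N -> completePseudoMetricType R) (T : hat X -> hat Y) :=
  forall (t : 'I_N) (a a' : hat X),
    (forall s : 'I_N, (s <= t)%N -> a.1 s = a'.1 s /\ a.2 s = a'.2 s) ->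
    (T a).1 t = (T a').1 t /\ (T a).2 t = (T a').2 t.

Definition biadapted (X Y : 'I_N -> completePseudoMetricType R) (T : hat X -> hat Y) :=
  measurable_fun [set: HatM X] (T : HatM X -> HatM Y) /\
  exists S : hat Y -> hat X,
    cancel T S /\ cancel S T /\
    measurable_fun [set: HatM Y] (S : HatM Y -> HatM X) /\
    adapted X Y T /\ adapted Y X S.

End defs.

Arguments polish {R}.
Arguments borel : clear implicits.
Arguments cyl {R N}.
Arguments cyl_upto {R N}.
Arguments PiM {R N}.
Arguments hat {R N}.
Arguments hcyl {R N}.
Arguments HatM {R N}.
Arguments lebN {R N}.
Arguments iint {R N}.
Arguments hatmeasure {R N}.
Arguments coupling {R N}.
Arguments causal {R N}.
Arguments bicausal {R N}.
Arguments adapted {R N}.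
Arguments biadapted {R N}.

(* Main.v *)
(** Write [hat mu] for [mu] times [N] independent uniform noises.

    If [T] is biadapted, [x |-> law of (T (x, u)).1 under the noise u] is a version of
    the disintegration of [pi], and adaptedness of [T] makes it causal; the same
    applied to the inverse of [T] gives bicausality.

    Conversely [T] is built one time step at a time, together with its inverse.
    Given the bijection of the histories before [t], draw the new coordinate as
    [y = q (x_{<=t}, y_{<t}, p1 u_t)], where [q] randomizes the conditional law under
    [pi] and [(p1, p2)] splits the noise [u_t] into two independent ones, and let [v] be
    the conditional distribution function of a real code of [(x_t, u_t)] given the
    history and [y], evaluated at that code.  The unused half [p2 u_t] makes this
    conditional law atomless, so that [v] is uniform and independent of the history and
    [y], and [(x_t, u_t)] can almost surely be recovered from [(y, v)].  Codes with
    values in a null set turn this almost sure bijection into two exact injections,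
    and a measurable Cantor-Bernstein argument, uniform in the history, turns those
    into an exact bijection which almost surely agrees with the original map.
    Bicausality is used twice: in one direction it gives the law of [(x_{<=t}, y_{<t})],
    in the other it shows that [y] depends on the enlarged history only through
    [y_{<t}], which yields [T_* hat mu = hat nu]. *)
Require Import Defs.
From HB Require Import structures.
From mathcomp Require Import all_boot all_order all_algebra.
From mathcomp Require Import all_classical all_reals all_analysis measurable_realfun.
From mathcomp Require Import ring.
Import Order.TTheory GRing.Theory Num.Theory.
Import numFieldNormedType.Exports.
Local Open Scope classical_set_scope.
Local Open Scope ring_scope.
Set Implicit Arguments.
Unset Strict Implicit.

(** * Laws of random variables *)


(** A biadapted map is inverted at every point, so null sets cannot be discarded, although $X_t$ may
    be a single point while $Y_t$ is uncountable. The factor $[0,1]$ leaves room for the repair: a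
    Lebesgue null subset of it already carries a copy of each space involved. Conditional laws are
    represented by measurable functions of the past and of an independent uniform variable.
    Conditional statements thus become equalities in law, which are stable under measurable maps and
    under adding independent noise. Real codes enter because this representation uses quantiles,
    hence an order. The delicate point of the induction is that $y_t$ is drawn with knowledge of
    $x_t$, while the enlarged history also contains the past noises. These are independent of the
    path, so after averaging over $x_t$ given $x_{<t}$ the conditional law of $y_t$ depends only on
    $(x_{<t}, y_{<t})$; causality from $Y$ to $X$ then removes $x_{<t}$. *)

Lemma measurable_preimageT {d d'} {T : measurableType d} {T' : measurableType d'}
  (f : T -> T') (B : set T') :
  measurable_fun setT f -> measurable B -> measurable (f @^-1` B).
Proof. by move=> mf mB; rewrite -[X in measurable X]setTI; exact: mf. Qed.

Lemma measurable_fun_gen d (A : measurableType d) (T : pointedType)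
  (G : set (set T)) (f : A -> g_sigma_algebraType G) :
  (forall B, G B -> measurable (f @^-1` B)) -> measurable_fun setT f.
Proof.
move=> H; apply: (@measurability _ _ A (g_sigma_algebraType G) setT f G) => //.
by move=> _ [B GB <-]; rewrite setTI; exact: H.
Qed.

Section law.
Context d d' (T : measurableType d) (T' : measurableType d') (R : realType).
Variables (P : probability T R) (f : T -> T').

(** The measurability proof is an argument so that the measure and probability structures can be
    attached to the pushforward. *)
Definition law (mf : measurable_fun setT f) : set T' -> \bar R := pushforward P f.

Variable mf : measurable_fun setT f.

Let law0 : law mf set0 = 0%E.
Proof. by rewrite /law /pushforward preimage_set0 measure0. Qed.

Let law_ge0 A : (0 <= law mf A)%E.
Proof. exact: measure_ge0. Qed.

Let law_sigma_additive : semi_sigma_additive (law mf).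
Proof.
move=> F mF tF mUF; rewrite /law /pushforward preimage_bigcup.
apply: measure_semi_sigma_additive.
- by move=> n; exact: measurable_preimageT.
- apply/trivIsetP => /= i j _ _ ij; rewrite -preimage_setI.
  by move/trivIsetP : tF => /(_ _ _ _ _ ij) ->//; rewrite preimage_set0.
- by rewrite -preimage_bigcup; exact: measurable_preimageT.
Qed.

HB.instance Definition _ := isMeasure.Build _ _ _ (law mf)
  law0 law_ge0 law_sigma_additive.

Let law_setT : law mf setT = 1%E.
Proof. by rewrite /law /pushforward preimage_setT probability_setT. Qed.

HB.instance Definition _ := Measure_isProbability.Build _ _ _ (law mf) law_setT.

Lemma ge0_integral_law (g : T' -> \bar R) : measurable_fun setT g ->
  (forall y, 0 <= g y)%E -> (\int[law mf]_y g y = \int[P]_x g (f x))%E.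
Proof. by move=> mg g0; rewrite ge0_integral_pushforward. Qed.

End law.

Section pprod.
Context d1 d2 (T1 : measurableType d1) (T2 : measurableType d2) (R : realType).
Variables (P : probability T1 R) (Q : probability T2 R).
Local Open Scope ereal_scope.

(** A separate name, on which a probability structure is declared, so that products can be
    iterated. *)
Definition pprod : set (T1 * T2) -> \bar R := P \x Q.

HB.instance Definition _ := Measure.on pprod.

Let pprod_setT : pprod setT = 1.
Proof.
rewrite -setXTT [LHS]product_measure1E// -[RHS]mule1.
by rewrite -{1}(probability_setT P) -(probability_setT Q).
Qed.

HB.instance Definition _ := Measure_isProbability.Build _ _ _ pprod pprod_setT.

Lemma pprodE C : pprod C = \int[P]_x Q [set y | C (x, y)].
Proof.
apply: eq_integral => x _ /=; congr (Q _).
by apply/seteqP; split => y; rewrite /xsection/= in_setE.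
Qed.

Lemma pprodX A B : measurable A -> measurable B ->
  pprod (A `*` B) = P A * Q B.
Proof. by move=> mA mB; rewrite /pprod product_measure1E. Qed.

Lemma measurable_section (C : set (T1 * T2)) x :
  measurable C -> measurable [set y | C (x, y)].
Proof. exact: (measurable_preimageT (pair1_measurable x)). Qed.

Lemma measurable_fun_section (C : set (T1 * T2)) : measurable C ->
  measurable_fun setT (fun x => Q [set y | C (x, y)]).
Proof.
move=> mC; have := measurable_fun_xsection Q mC.
apply: eq_measurable_fun => x _ /=; congr (Q _).
by apply/seteqP; split => y; rewrite /xsection/= in_setE.
Qed.

Lemma pprodE_fst C A : measurable C -> measurable A ->
  pprod (C `&` fst @^-1` A) = \int[P]_(x in A) Q [set y | C (x, y)].
Proof.
move=> mC mA; rewrite pprodE [RHS]integral_mkcond; apply: eq_integral => x _.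
rewrite patchE; case: ifPn => [/set_mem xA|/negP xA].
  by congr (Q _); apply/seteqP; split => [y []|y].
rewrite [X in Q X](_ : _ = set0) ?measure0// -subset0 => y /= [_ Ax].
by apply: xA; exact/mem_set.
Qed.

End pprod.

Lemma measureI_full d (T : measurableType d) (R : realType) (P : probability T R)
  (A D : set T) : measurable A -> measurable D -> P (~` D) = 0%E ->
  P A = P (A `&` D).
Proof.
move=> mA mD D0; have mCD : measurable (~` D) by exact: measurableC.
rewrite -[in LHS](setIT A) -(setUv D) setIUr.
rewrite measureU; first last.
- by rewrite -setIIr setICr setI0.
- exact: measurableI.
- exact: measurableI.
rewrite [X in (_ + X)%E](_ : _ = 0%E) ?adde0//.
apply/eqP; rewrite -measure_le0 -D0; apply: le_measure; rewrite ?inE//.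
exact: measurableI.
Qed.

Lemma measure0_sub d (T : measurableType d) (R : realType) (P : probability T R)
  (A B : set T) : measurable A -> measurable B -> A `<=` B -> P B = 0%E ->
  P A = 0%E.
Proof.
move=> mA mB AB B0; apply/eqP; rewrite -measure_le0 -B0.
by apply: le_measure; rewrite ?inE.
Qed.

(** Measurable rectangles are stable under intersection and generate the product sigma-algebra. *)
Lemma finite_measure_eq_prod (R : realType) d d' (E : measurableType d) (E' : measurableType d')
  (m1 m2 : {finite_measure set (E * E')%type -> \bar R}) :
  (forall A B, measurable A -> measurable B -> m1 (A `*` B) = m2 (A `*` B)) ->
  forall C, measurable C -> m1 C = m2 C.
Proof.
move=> H C mC; pose G : set (set (E * E')) :=
  [set A `*` B | A in measurable & B in measurable].
apply: (@measure_unique _ _ _ G (fun=> setT)) => //.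
- by rewrite measurable_prod_measurableType.
- move=> _ _ [A mA [B mB <-]] [A' mA' [B' mB' <-]].
  exists (A `&` A'); first exact: measurableI.
  by exists (B `&` B'); [exact: measurableI|rewrite setXI].
- by move=> _; exists setT => //; exists setT => //; rewrite setXTT.
- by rewrite bigcup_const.
- by move=> _ [A mA [B mB <-]]; exact: H.
- by move=> _; rewrite -ge0_fin_numE//; exact: fin_num_measure.
Qed.

Lemma integrable_bounded d (T : measurableType d) (R : realType)
  (P : probability T R) (f : T -> \bar R) : measurable_fun setT f ->
  (forall x, 0 <= f x <= 1)%E -> P.-integrable setT f.
Proof.
move=> mf f01; apply: (@le_integrable _ _ _ _ _ measurableT _ (cst 1%E)) => //.
  by move=> x _; have /andP[? ?] := f01 x; rewrite gee0_abs//= normr1.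
exact: finite_measure_integrable_cst.
Qed.

Section same_law.
Context (R : realType).

(** Stated for bare set functions, so that chains of equalities in law carry neither instances nor
    measurability proofs. *)
Definition same_law d1 d2 d (T1 : measurableType d1) (T2 : measurableType d2)
  (E : measurableType d) (P1 : set T1 -> \bar R) (f1 : T1 -> E)
  (P2 : set T2 -> \bar R) (f2 : T2 -> E) :=
  forall B, measurable B -> P1 (f1 @^-1` B) = P2 (f2 @^-1` B).

Context d1 d2 d3 d d' (T1 : measurableType d1) (T2 : measurableType d2)
  (T3 : measurableType d3) (E : measurableType d) (E' : measurableType d').

Lemma same_law_sym (P1 : set T1 -> \bar R) (P2 : set T2 -> \bar R)
  (f1 : T1 -> E) (f2 : T2 -> E) : same_law P1 f1 P2 f2 -> same_law P2 f2 P1 f1.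
Proof. by move=> H B mB; rewrite H. Qed.

Lemma same_law_trans (P1 : set T1 -> \bar R) (P2 : set T2 -> \bar R)
  (P3 : set T3 -> \bar R) (f1 : T1 -> E) (f2 : T2 -> E) (f3 : T3 -> E) :
  same_law P1 f1 P2 f2 -> same_law P2 f2 P3 f3 -> same_law P1 f1 P3 f3.
Proof. by move=> H H' B mB; rewrite H// H'. Qed.

Lemma same_law_comp (P1 : set T1 -> \bar R) (P2 : set T2 -> \bar R)
  (f1 : T1 -> E) (f2 : T2 -> E) (g : E -> E') : measurable_fun setT g ->
  same_law P1 f1 P2 f2 -> same_law P1 (g \o f1) P2 (g \o f2).
Proof.
by move=> mg H B mB; apply: (H (g @^-1` B)); exact: measurable_preimageT.
Qed.

Lemma same_law_pair (P1 : probability T1 R) (P2 : probability T2 R)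
  (f1 : T1 -> E) (f2 : T2 -> E) (g1 : T1 -> E') (g2 : T2 -> E') :
  measurable_fun setT f1 -> measurable_fun setT f2 ->
  measurable_fun setT g1 -> measurable_fun setT g2 ->
  (forall A B, measurable A -> measurable B ->
    P1 (f1 @^-1` A `&` g1 @^-1` B) = P2 (f2 @^-1` A `&` g2 @^-1` B)) ->
  same_law P1 (fun x => (f1 x, g1 x)) P2 (fun x => (f2 x, g2 x)).
Proof.
move=> mf1 mf2 mg1 mg2 H.
have m1 := measurable_fun_pair mf1 mg1; have m2 := measurable_fun_pair mf2 mg2.
move=> C mC; change (law P1 m1 C = law P2 m2 C).
by apply: finite_measure_eq_prod => // A B mA mB; exact: H.
Qed.

Lemma same_law_ae (P : probability T1 R) (f g : T1 -> E) (D : set T1) :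
  measurable_fun setT f -> measurable_fun setT g -> measurable D ->
  P (~` D) = 0%E -> {in D, f =1 g} -> same_law P f P g.
Proof.
move=> mf mg mD D0 fg B mB.
have mfB := measurable_preimageT mf mB; have mgB := measurable_preimageT mg mB.
rewrite (measureI_full mfB mD D0) (measureI_full mgB mD D0).
congr (P _); apply/seteqP; split => x [Bx Dx]; split => //=.
  by rewrite -fg//; exact/mem_set.
by rewrite fg//; exact/mem_set.
Qed.

End same_law.

Lemma same_law_noise (R : realType) d1 d2 d3 d
  (T1 : measurableType d1) (T2 : measurableType d2) (T3 : measurableType d3)
  (E : measurableType d) (P1 : probability T1 R) (P2 : probability T2 R)
  (Q : probability T3 R) (f1 : T1 -> E) (f2 : T2 -> E) :
  measurable_fun setT f1 -> measurable_fun setT f2 ->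
  same_law P1 f1 P2 f2 ->
  same_law (pprod P1 Q) (fun p => (f1 p.1, p.2))
           (pprod P2 Q) (fun p => (f2 p.1, p.2)).
Proof.
move=> m1 m2 H; apply: same_law_pair => //.
- exact: measurableT_comp m1 measurable_fst.
- exact: measurableT_comp m2 measurable_fst.
move=> A B mA mB.
transitivity (pprod P1 Q ((f1 @^-1` A) `*` B)); first by [].
transitivity (pprod P2 Q ((f2 @^-1` A) `*` B)); last by [].
by rewrite !pprodX ?H//; exact: measurable_preimageT.
Qed.


Section transfer.
Context (R : realType) d d' (H : measurableType d) (G : measurableType d').
Variables (P : probability H R) (phi : H -> G).
Hypothesis mphi : measurable_fun setT phi.

(** The hypothesis says that [f1] and [f2] have equal integrals on all sets for the law of [phi].
    Hence they agree almost everywhere for that law, so [f1 \o phi] and [f2 \o phi] agree [P]-almost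
    everywhere, and their integrals agree also over sets that are not determined by [phi]. *)
Lemma integral_transfer (f1 f2 : G -> \bar R) :
  measurable_fun setT f1 -> measurable_fun setT f2 ->
  (forall x, 0 <= f1 x <= 1)%E -> (forall x, 0 <= f2 x <= 1)%E ->
  (forall C, measurable C -> \int[P]_(h in phi @^-1` C) f1 (phi h) =
                             \int[P]_(h in phi @^-1` C) f2 (phi h))%E ->
  forall A, measurable A ->
    (\int[P]_(h in A) f1 (phi h) = \int[P]_(h in A) f2 (phi h))%E.
Proof.
move=> mf1 mf2 f1b f2b eqf A mA.
have if1 : (law P mphi).-integrable setT f1 by exact: integrable_bounded.
have : ae_eq (law P mphi) setT f1 f2.
  apply: integral_ae_eq => // C _ mC.
  rewrite !ge0_integral_pushforward ?eqf//.
  - exact: measurable_funTS.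
  - by move=> x _; case/andP: (f2b x).
  - exact: measurable_funTS.
  - by move=> x _; case/andP: (f1b x).
case=> N [mN N0 subN].
apply: ae_eq_integral => //.
- by apply: measurable_funTS; exact: measurableT_comp.
- by apply: measurable_funTS; exact: measurableT_comp.
exists (phi @^-1` N); split => //; first exact: measurable_preimageT.
by move=> x /= Hx; apply: subN => /= K; apply: Hx => _; exact: K.
Qed.

(** Given [p.1], both variables depend on it only through [phi p.1] and on an independent noise.
    Equality of their conditional laws given [phi] is therefore equality of their conditional laws
    given [p.1]. *)
Lemma law_transfer d1 d2 dE (W1 : measurableType d1) (W2 : measurableType d2)
  (E : measurableType dE) (Q1 : probability W1 R) (Q2 : probability W2 R)
  (t1 : G * W1 -> E) (t2 : G * W2 -> E) :
  measurable_fun setT t1 -> measurable_fun setT t2 ->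
  same_law (pprod P Q1) (fun p => (phi p.1, t1 (phi p.1, p.2)))
           (pprod P Q2) (fun p => (phi p.1, t2 (phi p.1, p.2))) ->
  same_law (pprod P Q1) (fun p => (p.1, t1 (phi p.1, p.2)))
           (pprod P Q2) (fun p => (p.1, t2 (phi p.1, p.2))).
Proof.
move=> mt1 mt2 eqt.
have mt dW (W : measurableType dW) (t : G * W -> E) : measurable_fun setT t ->
    measurable_fun setT (fun p : H * W => t (phi p.1, p.2)).
  move=> mt; apply: (measurableT_comp mt); apply: measurable_fun_pair => //.
  exact: measurableT_comp.
apply: same_law_pair => //; [exact: mt|exact: mt|move=> A B mA mB].
have E0 dW (W : measurableType dW) (Q : probability W R) (t : G * W -> E) A' :
    measurable_fun setT t -> measurable A' ->
    pprod P Q ((fun p => p.1) @^-1` A' `&`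
       (fun p => t (phi p.1, p.2)) @^-1` B) =
    (\int[P]_(h in A') Q [set w | (t @^-1` B) (phi h, w)])%E.
  move=> mtt mA'; rewrite setIC pprodE_fst//.
  by apply: measurable_preimageT => //; exact: mt.
rewrite [LHS](E0 _ _ Q1 t1 A mt1 mA) [RHS](E0 _ _ Q2 t2 A mt2 mA).
pose f dW (W : measurableType dW) (Q : probability W R) (t : G * W -> E) :=
  fun g => Q [set w | (t @^-1` B) (g, w)].
have mf dW (W : measurableType dW) (Q : probability W R) (t : G * W -> E) :
    measurable_fun setT t -> measurable_fun setT (f _ _ Q t).
  by move=> mtt; apply: measurable_fun_section; exact: measurable_preimageT.
have f01 dW (W : measurableType dW) (Q : probability W R) (t : G * W -> E) :
    measurable_fun setT t -> forall x, (0 <= f _ _ Q t x <= 1)%E.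
  move=> mtt x; rewrite measure_ge0/= probability_le1//.
  by apply: measurable_section; exact: measurable_preimageT.
apply: (integral_transfer (mf _ _ Q1 _ mt1) (mf _ _ Q2 _ mt2)) => //.
- exact: f01.
- exact: f01.
move=> C mC; have mCphi := measurable_preimageT mphi mC.
rewrite -[LHS](E0 _ _ Q1 t1 _ mt1 mCphi) -[RHS](E0 _ _ Q2 t2 _ mt2 mCphi).
by apply: (eqt (C `*` B)); exact: measurableX.
Qed.

End transfer.

(** * Coding Polish spaces by real numbers *)

Section cantor_code.
Variable R : realType.

(* Partial sums of [sum_i 2 (s i) / 3 ^ i.+1]. *)
Fixpoint ternaryn (n : nat) (s : nat -> bool) : R :=
  match n with
  | 0 => 0
  | n'.+1 => (2 * (s 0%N)%:R + ternaryn n' (fun i => s i.+1)) / 3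
  end.

Lemma ternaryn_bound n s : 0 <= ternaryn n s <= 1.
Proof.
elim: n s => [|n IH] s /=; first by rewrite lexx ler01.
have /andP[h0 h1] := IH (fun i => s i.+1).
rewrite divr_ge0 ?ler0n ?addr_ge0 ?mulr_ge0 ?ler0n//=.
rewrite ler_pdivrMr ?ltr0n// mul1r (_ : 3 = 2 * 1 + 1 :> R); last first.
  by rewrite mulr1 natr1.
by rewrite lerD// ler_pM2l ?ltr0n// lern1; case: (s 0%N).
Qed.

Lemma ternaryn_nd s : nondecreasing_seq (fun n => ternaryn n s).
Proof.
apply/nondecreasing_seqP => n; elim: n s => [|n IH] s.
  by have /andP[] := ternaryn_bound 1 s.
rewrite [leLHS]/= [leRHS]/=.
by rewrite ler_pM2r ?invr_gt0 ?ltr0n// lerD2l; exact: IH.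
Qed.

Lemma ternaryn_is_cvg s : cvgn (fun n => ternaryn n s).
Proof.
apply: nondecreasing_is_cvgn; first exact: ternaryn_nd.
by exists 1 => _ [n _ <-]; case/andP: (ternaryn_bound n s).
Qed.

Definition ternary (s : nat -> bool) : R := limn (fun n => ternaryn n s).

Lemma ternary_bound s : 0 <= ternary s <= 1.
Proof.
apply/andP; split.
  apply: limr_ge; first exact: ternaryn_is_cvg.
  by near=> n; case/andP: (ternaryn_bound n s).
apply: limr_le; first exact: ternaryn_is_cvg.
by near=> n; case/andP: (ternaryn_bound n s).
Unshelve. all: by end_near. Qed.

Lemma ternaryE s :
  ternary s = (2 * (s 0%N)%:R + ternary (fun i => s i.+1)) / 3.
Proof.
apply/cvg_lim => //.
rewrite -(@cvg_shiftS _ (fun n => ternaryn n s)) /=.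
by apply: cvgMl; apply: cvgD; [exact: cvg_cst|exact: ternaryn_is_cvg].
Qed.

Lemma measurable_ternary d (A : measurableType d) (s : A -> nat -> bool) :
  (forall n, measurable_fun setT (fun a => s a n)) ->
  measurable_fun setT (fun a => ternary (s a)).
Proof.
move=> ms; apply: (measurable_fun_cvg (h := fun n a => ternaryn n (s a))).
  move=> n; elim: n s ms => [|n IH] s ms /=; first exact: measurable_cst.
  apply: measurable_funM; last exact: measurable_cst.
  apply: measurable_funD; last by apply: IH => i; exact: ms.
  apply: measurable_funM; first exact: measurable_cst.
  rewrite (_ : (fun _ => _) = (fun a => if s a 0%N then 1 else 0)); last first.
    by apply/funext => a; case: (s a 0%N).
  by apply: measurable_fun_ifT => //; exact: measurable_cst.
by move=> a _; exact: ternaryn_is_cvg.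
Qed.

(** With [b] the leading bit of [r], the map [r |-> 3 r - 2 b] is the left shift of expansions with
    ternary digits 0 and 2. *)
Fixpoint ternary_tail (n : nat) (r : R) : R :=
  match n with
  | 0 => r
  | n'.+1 => let r' := ternary_tail n' r in 3 * r' - 2 * ((2^-1 <= r')%R : bool)%:R
  end.

Definition ternary_bit (r : R) (n : nat) : bool := 2^-1 <= ternary_tail n r.

Lemma measurable_ternary_bit n :
  measurable_fun setT (fun r : R => ternary_bit r n).
Proof.
rewrite /ternary_bit; suff H : measurable_fun setT (ternary_tail n).
  by apply: measurable_fun_ler => //; exact: measurable_cst.
elim: n => [|n IH] /=; first exact: measurable_id.
apply: measurable_funB.
  by apply: measurable_funM => //; exact: measurable_cst.
apply: measurable_funM; first exact: measurable_cst.
rewrite (_ : (fun _ => _) =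
  (fun r : R => if 2^-1 <= ternary_tail n r then 1 else 0)); last first.
  by apply/funext => a; case: ifP.
apply: measurable_fun_ifT => //; try exact: measurable_cst.
by apply: measurable_fun_ler => //; exact: measurable_cst.
Qed.

(** The digits are 0 and 2: a leading 0 gives a value at most 1/3, a leading 2 a value at least 2/3,
    so comparison with 1/2 reads the digit. *)
Lemma ternary_head s : (2^-1 <= ternary s) = s 0%N.
Proof.
have /andP[h0 h1] := ternary_bound (fun i => s i.+1).
rewrite ternaryE; case: (s 0%N).
  rewrite mulr1 ler_pdivlMr ?ltr0n// (le_trans (_ : _ <= 2%:R))//.
    by rewrite mulrC ler_pdivrMr ?ltr0n// -natrM ler_nat.
  by rewrite lerDl.
rewrite mulr0 add0r; apply/negbTE; rewrite -ltNge ltr_pdivrMr ?ltr0n//.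
by rewrite (le_lt_trans h1)// mulrC ltr_pdivlMr ?ltr0n// mul1r ltr_nat.
Qed.

Lemma ternary_tailE n s : ternary_tail n (ternary s) = ternary (fun i => s (n + i)%N).
Proof.
elim: n => [//|n IH] /=; rewrite IH ternary_head ternaryE addn0.
rewrite mulrCA mulfV ?mulr1 ?pnatr_eq0// addrAC subrr add0r.
by congr ternary; apply/funext => i; rewrite addnS.
Qed.

Lemma ternaryK s : ternary_bit (ternary s) = s.
Proof.
by apply/funext => n; rewrite /ternary_bit ternary_tailE ternary_head addn0.
Qed.

End cantor_code.

Section standard.
Variable R : realType.

(* [bitcoded E]: the Borel structure of [E] is carried by a measurable subset of
   the Cantor space, which is not itself given a measurable structure. *)
Definition bitcoded d (E : measurableType d) :=
  exists (b : E -> nat -> bool) (dec : (nat -> bool) -> E),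
    [/\ forall n, measurable_fun setT (fun e => b e n),
        forall s : R -> nat -> bool,
          (forall n, measurable_fun setT (fun a => s a n)) ->
          measurable_fun setT (fun a => dec (s a))
      & cancel b dec].

(** The real counterpart of [bitcoded]: bit sequences combine easily into products, whereas
    quantiles need an ordered and bounded code. *)
Definition standard d (E : measurableType d) :=
  exists (c : E -> R) (dec : R -> E),
    [/\ measurable_fun setT c, measurable_fun setT dec, cancel c dec
      & forall e, 0 <= c e <= 1].

Lemma bitcoded_standard d (E : measurableType d) : bitcoded E -> standard E.
Proof.
move=> [b [dec [mb mdec bK]]].
exists (fun e => ternary R (b e)), (fun r => dec (ternary_bit r)); split.
- exact: measurable_ternary.
- by apply: mdec => n; exact: measurable_ternary_bit.
- by move=> e; rewrite ternaryK bK.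
- by move=> e; exact: ternary_bound.
Qed.

Lemma bitcoded_retract d d' (E : measurableType d) (E' : measurableType d')
  (i : E -> E') (r : E' -> E) :
  measurable_fun setT i -> measurable_fun setT r -> cancel i r ->
  bitcoded E' -> bitcoded E.
Proof.
move=> mi mr irK [b [dec [mb mdec bK]]].
exists (fun e => b (i e)), (fun s => r (dec s)); split.
- by move=> n; exact: (measurableT_comp (mb n) mi).
- by move=> s ms; apply: (measurableT_comp mr); exact: mdec.
- by move=> e; rewrite bK irK.
Qed.

Lemma bitcoded_prod d d' (E : measurableType d) (E' : measurableType d') :
  bitcoded E -> bitcoded E' -> bitcoded (E * E')%type.
Proof.
move=> [b [dec [mb mdec bK]]] [b' [dec' [mb' mdec' bK']]].
exists (fun p n => if odd n then b' p.2 n./2 else b p.1 n./2).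
exists (fun s => (dec (fun n => s n.*2), dec' (fun n => s n.*2.+1))); split.
- move=> n; case: (odd n).
    exact: (measurableT_comp (mb' _) measurable_snd).
  exact: (measurableT_comp (mb _) measurable_fst).
- by move=> s ms; apply: measurable_fun_pair; [exact: mdec|exact: mdec'].
- case=> e e' /=; rewrite -[RHS](f_equal2 pair (bK e) (bK' e')).
  congr (dec _, dec' _); apply/funext => n; rewrite ?oddS odd_double //=.
    by rewrite doubleK.
  by rewrite uphalf_double.
Qed.

End standard.

Section polish_code.
Variables (R : realType) (T : completePseudoMetricType R) (x_ : nat -> T).
Hypothesis T2 : hausdorff_space T.
Hypothesis x_dense : forall O : set T, open O -> O !=set0 -> exists i, O (x_ i).

Let r (k : nat) : R := 2 ^- k.

Let r_gt0 k : 0 < r k. Proof. by rewrite invr_gt0 exprn_gt0. Qed.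

Let rS k : r k = r k.+1 + r k.+1.
Proof.
rewrite /r exprS invfM -mulrDl -[LHS]mul1r; congr (_ * _).
by rewrite -mulr2n -[LHS](@mulVf R 2) ?pnatr_eq0// mulr_natr.
Qed.

(** Balls of a pseudometric structure need not be open; the interior makes each bit a Borel function
    of the point. *)
Definition near_bit (x : T) (i k : nat) : Prop := (ball (x_ i) (r k))° x.

Lemma near_bit_exists x k : exists i, near_bit x i k.
Proof.
have [||i Oi] := x_dense (O := (ball x (r k.+1))°).
- exact: open_interior.
- by exists x; exact: nbhsx_ballx.
exists i; have {}Oi := interior_subset Oi.
apply/nbhs_ballP; exists (r k.+1); first exact: r_gt0.
by move=> y xy; rewrite rS; apply: ball_triangle xy; exact: ball_sym.
Qed.

Definition polish_bits (x : T) (n : nat) : bool :=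
  if unpickle n is Some (i, k) then `[< near_bit x i k >] else false.

Definition first_index (s : nat -> bool) (k : nat) : nat :=
  if pselect (exists i, s (pickle (i, k))) is left h then ex_minn h else 0%N.

(** A point within [r k] of [x_ i] and within [r k.+1] of [x_ j] forces this inequality, so the test
    always succeeds along the code of a point. *)
Definition close_index (i j k : nat) : bool :=
  `[< ball (x_ i) (r k + r k.+1) (x_ j) >].

(** An arbitrary bit sequence need not code a point. Rejecting an index that jumps too far makes the
    centres Cauchy for every sequence, so that the decoder is total and its limit exists. *)
Fixpoint cauchy_index (s : nat -> bool) (k : nat) : nat :=
  match k with
  | 0 => first_index s 0
  | k'.+1 => if close_index (cauchy_index s k') (first_index s k'.+1) k'
             then first_index s k'.+1 else cauchy_index s k'
  end.

Lemma polish_bits_first x k : ball (x_ (first_index (polish_bits x) k)) (r k) x.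
Proof.
rewrite /first_index; case: pselect => [h|]; last first.
  move=> h; exfalso; apply: h; have [i xi] := near_bit_exists x k.
  by exists i; rewrite /polish_bits pickleK; exact/asboolP.
case: ex_minnP => i; rewrite /polish_bits pickleK => /asboolP xi _.
exact: interior_subset.
Qed.

Lemma cauchy_index_polish x k :
  cauchy_index (polish_bits x) k = first_index (polish_bits x) k.
Proof.
elim: k => [//|k IH] /=; rewrite IH /close_index; case: asboolP => //.
case; apply: (@ball_triangle _ _ x); first exact: polish_bits_first.
by apply: ball_sym; exact: polish_bits_first.
Qed.

(** One step moves by less than [r k + r k.+1 = 3 * (r k - r k.+1)], which telescopes to
    [3 * (r k - r l)]; the additional [r k] keeps the radius positive when [k = l]. *)
Lemma cauchy_index_ball s k l : (k <= l)%N ->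
  ball (x_ (cauchy_index s k)) (4 * r k - 3 * r l) (x_ (cauchy_index s l)).
Proof.
elim: l => [|l IH]; first last.
  rewrite leq_eqVlt => /predU1P[<-|kl].
    by rewrite -mulrBl; apply: ballxx; rewrite mulr_gt0// subr_gt0 ltr_nat.
  rewrite (_ : _ - _ = (4 * r k - 3 * r l) + (r l + r l.+1)); last first.
    by rewrite (rS l); ring.
  apply: (@ball_triangle _ _ (x_ (cauchy_index s l))); first exact: IH.
  rewrite [cauchy_index s l.+1]/=; case: ifP => [/asboolP//|_].
  by apply: ballxx; rewrite addr_gt0.
rewrite leqn0 => /eqP ->.
by rewrite -mulrBl; apply: ballxx; rewrite mulr_gt0// subr_gt0 ltr_nat.
Qed.

Definition polish_seq s (k : nat) : T := x_ (cauchy_index s k).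

Lemma r_small (e : R) : 0 < e -> exists k, r k < e.
Proof.
move=> e0; have : r k @[k --> \oo] --> (0 : R).
  rewrite /r (_ : (fun k => _) = (fun k => 2^-1 ^+ k)); last first.
    by apply/funext => k; rewrite exprVn.
  apply: cvg_expr; rewrite ger0_norm ?invr_ge0 ?ler0n//.
  by rewrite invf_lt1 ?ltr0n// ltr1n.
move/cvgrPdist_lt => /(_ _ e0) [k _ /(_ k (leqnn _))] /=.
rewrite sub0r normrN ger0_norm ?ltW//; by exists k.
Qed.

Lemma polish_seq_cvg s : cvgn (polish_seq s).
Proof.
apply: cauchy_cvg; apply: cauchy_exP => e e0.
have [k rk] := r_small (divr_gt0 e0 (ltr0n R 4)).
exists (polish_seq s k); exists k => // l /= kl.
apply: (@le_ball _ _ _ (4 * r k - 3 * r l)).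
  rewrite lerBlDr (le_trans (_ : _ <= e))//.
    by rewrite mulrC -ler_pdivlMr ?ltr0n// ltW.
  by rewrite lerDl mulr_ge0// ltW.
exact: cauchy_index_ball.
Qed.

Definition polish_dec s : T := lim (polish_seq s @ \oo).

Lemma polish_bitsK : cancel polish_bits polish_dec.
Proof.
move=> x; apply/cvg_lim => //; apply/cvg_ballP => e e0.
have [k rk] := r_small e0; near=> l.
apply: ball_sym; rewrite /polish_seq cauchy_index_polish.
apply: (@le_ball _ _ _ (r l)); last exact: polish_bits_first.
apply: ltW; apply: le_lt_trans rk.
rewrite lef_pV2 ?posrE ?exprn_gt0// ler_eXn2l ?ltr1n//.
by near: l; exact: nbhs_infty_ge.
Unshelve. all: by end_near. Qed.

(** Membership of the limit is rewritten with countable quantifiers over centres, from which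
    measurability follows. The margin [r m] is the same for all late [k], so it survives the passage
    to the limit. *)
Lemma polish_dec_open s (O : set T) : open O ->
  O (polish_dec s) <-> exists m K, forall k, (K <= k)%N ->
    ball (polish_seq s k) (r m) `<=` O.
Proof.
move=> oO; have cvs := @polish_seq_cvg s; split.
  move=> Os; have /nbhs_ballP[e /= e0 eO] := open_nbhs_nbhs (conj oO Os).
  have [m rm] := r_small (divr_gt0 e0 (ltr0n R 2)).
  have /cvg_ball/(_ _ (r_gt0 m))[K _ HK] := cvs.
  exists m, K => k Kk y yk; apply: eO.
  apply: (@le_ball _ _ _ (r m + r m)).
    by rewrite [leRHS]splitr lerD// ltW.
  by apply: ball_triangle yk; exact: HK.
move=> [m [K H]]; have /cvg_ball/(_ _ (r_gt0 m))[K' _ HK'] := cvs.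
apply: (H (maxn K K')); first exact: leq_maxl.
by apply: ball_sym; apply: HK' => /=; exact: leq_maxr.
Qed.

Section measurability.
Variables (d : measure_display) (A : measurableType d) (s : A -> nat -> bool).
Hypothesis ms : forall n, measurable_fun setT (fun a => s a n).

Let ms1 n b : measurable [set a | s a n = b].
Proof. exact: (measurable_preimageT (ms n) (B := [set b])). Qed.

Lemma measurable_first_index k m : measurable [set a | first_index (s a) k = m].
Proof.
pose b (i : nat) := [set a | s a (pickle (i, k)) = false].
have mb i : measurable (b i) by exact: ms1.
have mU : measurable (\bigcap_i b i) by exact: bigcapT_measurable.
have mV : measurable (\bigcap_(i in [set i | (i < m)%N]) b i).
  exact: bigcap_measurableType.
(* The second part accounts for the default index 0, taken when no bit of level [k] is set. *)
have -> : [set a | first_index (s a) k = m] =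
  ([set a | s a (pickle (m, k)) = true] `&` \bigcap_(i in [set i | (i < m)%N]) b i)
   `|` ((\bigcap_i b i) `&` [set _ | m = 0%N]).
  apply/seteqP; split => a; rewrite /first_index /=.
    case: pselect => [h|h <-].
      case: ex_minnP => n sn nmin <-; left; split => // i /= im.
      by apply/negbTE/negP => /nmin; rewrite leqNgt im.
    right; split => // i _; apply/negbTE/negP => si; apply: h.
    by exists i.
  move=> [[sm lm]|[h ->]]; case: pselect => //= h'.
  - case: ex_minnP => n sn nmin; apply/eqP; rewrite eqn_leq nmin// leqNgt.
    by apply/negP => /lm /=; rewrite /b /= sn.
  - by exfalso; apply: h'; exists m.
  - by case: h' (h') => i si h'; have := h i I; rewrite /b /= si.
apply: measurableU; first by apply: measurableI => //; exact: ms1.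
apply: measurableI => //; have [e|e] := pselect (m = 0%N).
  by rewrite (_ : [set _ | _] = setT)//; apply/seteqP; split.
by rewrite (_ : [set _ | _] = set0)//; apply/seteqP; split.
Qed.

Lemma measurable_cauchy_index k m : measurable [set a | cauchy_index (s a) k = m].
Proof.
elim: k m => [|k IH] m; first exact: measurable_first_index.
pose F i j := if close_index i j k then j else i.
have -> : [set a | cauchy_index (s a) k.+1 = m] =
  \bigcup_i \bigcup_(j in [set j | F i j = m])
    ([set a | cauchy_index (s a) k = i] `&` [set a | first_index (s a) k.+1 = j]).
  apply/seteqP; split => a /=.
    by move=> <-; exists (cauchy_index (s a) k) => //; exists (first_index (s a) k.+1).
  by move=> [i _ [j /= <- [<- <-]]].
apply: bigcupT_measurable => i; apply: bigcup_measurable => j _.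
by apply: measurableI; [exact: IH|exact: measurable_first_index].
Qed.

Lemma measurable_polish_dec :
  measurable_fun setT (fun a => polish_dec (s a) : g_sigma_algebraType (@open T)).
Proof.
apply: measurable_fun_gen => V oV.
have -> : (fun a => polish_dec (s a)) @^-1` V =
  \bigcup_m \bigcup_K \bigcap_(k in [set k | (K <= k)%N])
    \bigcup_(i in [set i | ball (x_ i) (r m) `<=` V])
      [set a | cauchy_index (s a) k = i].
  apply/seteqP; split => a /=.
    move/(polish_dec_open _ oV) => [m [K H]]; exists m => //; exists K => // k Kk.
    by exists (cauchy_index (s a) k) => //=; exact: H.
  move=> [m _ [K _ H]]; apply/(polish_dec_open _ oV); exists m, K => k Kk.
  by have [i /= iO ai] := H k Kk; rewrite /polish_seq ai.
apply: bigcupT_measurable => m; apply: bigcupT_measurable => K.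
apply: bigcap_measurableType => k _; apply: bigcup_measurable => i _.
exact: measurable_cauchy_index.
Qed.

End measurability.

Lemma measurable_polish_bits n : measurable_fun setT
  (fun x : g_sigma_algebraType (@open T) => polish_bits x n).
Proof.
rewrite /polish_bits; case: (unpickle n) => [[i k]|]; last exact: measurable_cst.
apply: (measurable_fun_bool true); rewrite setTI.
apply: sub_sigma_algebra.
rewrite (_ : _ @^-1` _ = (ball (x_ i) (r k))°); first exact: open_interior.
by apply/seteqP; split => x /=; [move/asboolP|move=> ?; exact/asboolP].
Qed.

Lemma dense_seq_bitcoded : bitcoded R (g_sigma_algebraType (@open T)).
Proof.
exists polish_bits, polish_dec; split.
- exact: measurable_polish_bits.
- by move=> s ms; exact: measurable_polish_dec.
- exact: polish_bitsK.
Qed.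

End polish_code.

Lemma polish_bitcoded (R : realType) (T : completePseudoMetricType R) :
  polish T -> bitcoded R (g_sigma_algebraType (@open T)).
Proof.
move=> [T2 [D [/countable_injP [f fD] dD]]].
(* The injection of the countable dense set into the naturals is turned into an enumeration; numbers
   that are not hit are sent to the base point. *)
have /choice[x_ x_P] (n : nat) : exists y, forall x, D x -> f x = n -> x = y.
  have [[y [Dy fy]]|h] := pselect (exists y, D y /\ f y = n).
    by exists y => x Dx fx; apply: fD; rewrite ?inE// fx fy.
  by exists point => x Dx fx; exfalso; apply: h; exists x.
apply: (@dense_seq_bitcoded _ _ x_) => // O oO O0.
by have [x [Ox Dx]] := dD _ O0 oO; exists (f x); rewrite -(x_P _ x).
Qed.

Lemma real_bitcoded (R : realType) : bitcoded R R.
Proof.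
have pR : polish (R : completePseudoMetricType R).
  split; first exact: Rhausdorff.
  exists (@ratr R @` setT); split; last exact: dense_rat.
  by apply: card_le_trans (card_image_le _ _) _; exact: countableP.
have m1 : measurable_fun setT (id : R -> g_sigma_algebraType (@open R)).
  apply: measurable_fun_gen => V oV; exact: open_measurable.
have m2 : measurable_fun setT (id : g_sigma_algebraType (@open R) -> R).
  apply: (measurability _ (RGenOpens.measurableE R)) => //; move=> _ [_ [x [y ->]] <-].
  rewrite setTI; apply: sub_sigma_algebra; exact: itv_open.
exact: bitcoded_retract m1 m2 (fun=> erefl) (polish_bitcoded pR).
Qed.

(** * The uniform noise *)

Section unit_interval.
Variable R : realType.

Definition I01_gen : set (set (I01 R)) :=
  [set A | exists D : set R, measurable D /\ A = sval @^-1` D].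

Definition I01M := g_sigma_algebraType I01_gen.

Definition ival (u : I01M) : R := sval u.
Definition iclamp (s : R) : I01M := clamp01 R s.

Lemma measurable_ival : measurable_fun setT ival.
Proof.
move=> _ D mD; rewrite setTI; apply: sub_sigma_algebra; by exists D.
Qed.

Lemma ival_iclamp s : ival (iclamp s) = if 0 <= s <= 1 then s else 0.
Proof. by rewrite /ival /iclamp /clamp01 /insubd; case: insubP => [u -> ->|/negbTE ->]. Qed.

Lemma ival_inj : injective ival.
Proof. exact: val_inj. Qed.

Lemma ivalK : cancel ival iclamp.
Proof.
by move=> u; apply: ival_inj; rewrite ival_iclamp /ival; case: u => s /= ->.
Qed.

Lemma ival_bound u : 0 <= ival u <= 1.
Proof. exact: (svalP u). Qed.

Lemma measurable_iclamp : measurable_fun setT iclamp.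
Proof.
apply: measurable_fun_gen => _ [D [mD ->]].
have m : measurable_fun setT (fun s : R => ival (iclamp s)).
  under eq_fun do rewrite ival_iclamp.
  apply: measurable_fun_ifT; [|exact: measurable_id|exact: measurable_cst].
  by apply: measurable_and; apply: measurable_fun_ler => //; exact: measurable_cst.
exact: (measurable_preimageT m mD).
Qed.

Lemma I01_bitcoded : bitcoded R I01M.
Proof.
apply: bitcoded_retract (real_bitcoded R).
- exact: measurable_ival.
- exact: measurable_iclamp.
- exact: ivalK.
Qed.

(* Going through an existence statement keeps [lam] from unfolding under [/=]. *)
Lemma lam_exists : exists P : probability I01M R,
  forall A, P A = law (uniform_prob (@ltr01 R)) measurable_iclamp A.
Proof. by exists (law (uniform_prob (@ltr01 R)) measurable_iclamp). Qed.

Definition lam : probability I01M R := sval (cid lam_exists).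

Lemma lamE A : lam A = law (uniform_prob (@ltr01 R)) measurable_iclamp A.
Proof. exact: (svalP (cid lam_exists)). Qed.

Lemma ge0_integral_lam (g : I01M -> \bar R) : measurable_fun setT g ->
  (forall u, 0 <= g u)%E ->
  (\int[lam]_u g u = \int[lebesgue_measure]_(s in `[0%R, 1%R]) g (clamp01 R s))%E.
Proof.
move=> mg g0; rewrite (eq_measure_integral
  (law (uniform_prob (@ltr01 R)) measurable_iclamp)); last first.
  by move=> A _ _; exact: lamE.
rewrite ge0_integral_law// integral_uniform//.
  by rewrite subr0 invr1 mul1e.
exact: (measurableT_comp mg measurable_iclamp).
Qed.

Lemma lam_itv (a b : R) : 0 <= a -> a <= b -> b <= 1 ->
  lam [set u | a <= ival u <= b] = (b - a)%:E.
Proof.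
move=> a0 ab b1.
have mA : measurable [set u | a <= ival u <= b].
  rewrite (_ : [set u | _] = ival @^-1` `[a, b]).
    exact: measurable_preimageT measurable_ival (measurable_itv _).
  by apply/seteqP; split => u /=; rewrite in_itv.
rewrite -(setIT [set u | _]) -integral_indic// ge0_integral_lam; last first.
- by move=> u; rewrite lee_fin.
- by apply/measurable_EFinP; exact: measurable_indic.
rewrite [LHS](_ : _ = \int[lebesgue_measure]_(s in `[0%R, 1%R])
    (\1_(`[a, b]%classic) s)%:E)%E; last first.
  apply: eq_integral => s; rewrite inE /= in_itv /= => s01; congr EFin; rewrite !indicE.
  congr (nat_of_bool _)%:R; apply/idP/idP; rewrite !inE /= in_itv /=.
    by have := ival_iclamp s; rewrite s01 /iclamp => ->.
  by have := ival_iclamp s; rewrite s01 /iclamp => ->.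
rewrite integral_indic// setIidl; last first.
  move=> s /=; rewrite !in_itv /= => /andP[sa sb].
  by rewrite (le_trans a0 sa) (le_trans sb b1).
rewrite [LHS]lebesgue_measure_itv/= lte_fin; move: ab.
by rewrite le_eqVlt => /predU1P[->|->]; rewrite ?ltxx ?subrr// EFinB.
Qed.

Lemma lam_le (t : \bar R) : (0 <= t <= 1)%E ->
  lam [set u | ((ival u)%:E <= t)%E] = t.
Proof.
case: t => [t| |]; rewrite ?leye_eq//.
rewrite !lee_fin => /andP[t0 t1].
rewrite (_ : [set u | _] = [set u | 0 <= ival u <= t]).
  by rewrite lam_itv// subr0.
  apply/seteqP; split => u /=; rewrite lee_fin; last by case/andP.
  by have /andP[-> _] := ival_bound u.
by case/andP.
Qed.

Lemma lam_eq (t : R) : lam [set u | ival u = t] = 0%E.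
Proof.
have [/andP[t0 t1]|t01] := boolP (0 <= t <= 1).
  rewrite -[RHS]/(0%:E) -(subrr t) -(lam_itv t0 (lexx t) t1); congr (lam _).
  apply/seteqP; split => u /=; first by move=> ->; rewrite lexx.
  by move=> h; apply/eqP; rewrite eq_le andbC.
rewrite (_ : [set u | _] = set0) ?measure0// -subset0 => u /= ut.
by move: t01; rewrite -ut ival_bound.
Qed.

End unit_interval.

(** * Restricted laws, almost sure comparison and densities *)

Section restricted_law.
Context d d' (T : measurableType d) (T' : measurableType d') (R : realType).
Variables (P : probability T R) (S : set T) (f : T -> T').

(** A finite measure below the law of [f]; its density with respect to that law is the conditional
    probability of [S] given [f]. *)
Definition rlaw (mS : measurable S) (mf : measurable_fun setT f) : set T' -> \bar R :=
  fun B => P (S `&` f @^-1` B).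

Hypotheses (mS : measurable S) (mf : measurable_fun setT f).

Let rlaw0 : rlaw mS mf set0 = 0%E.
Proof. by rewrite /rlaw preimage_set0 setI0 measure0. Qed.

Let rlaw_ge0 A : (0 <= rlaw mS mf A)%E.
Proof. exact: measure_ge0. Qed.

Let rlaw_sigma_additive : semi_sigma_additive (rlaw mS mf).
Proof.
move=> F mF tF mUF; rewrite /rlaw preimage_bigcup setI_bigcupr.
apply: measure_semi_sigma_additive.
- by move=> n; apply: measurableI => //; exact: measurable_preimageT.
- apply: trivIset_setIl; apply/trivIsetP => /= i j _ _ ij; rewrite -preimage_setI.
  by move/trivIsetP : tF => /(_ _ _ _ _ ij) ->//; rewrite preimage_set0.
- rewrite -setI_bigcupr -preimage_bigcup.
  by apply: measurableI => //; exact: measurable_preimageT.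
Qed.

HB.instance Definition _ := isMeasure.Build _ _ _ (rlaw mS mf)
  rlaw0 rlaw_ge0 rlaw_sigma_additive.

Lemma rlaw_le B : measurable B -> (rlaw mS mf B <= law P mf B)%E.
Proof.
move=> mB; apply: le_measure; rewrite ?inE; last exact: subIsetr.
- by apply: measurableI => //; exact: measurable_preimageT.
- exact: measurable_preimageT.
Qed.

Let rlaw_finite : fin_num_fun (rlaw mS mf).
Proof.
move=> B mB; rewrite ge0_fin_numE//.
rewrite (le_lt_trans (rlaw_le mB))// (le_lt_trans (probability_le1 _ mB))//.
exact: ltry.
Qed.

HB.instance Definition _ := Measure_isFinite.Build _ _ _ (rlaw mS mf) rlaw_finite.

End restricted_law.

Section comparison.
Context d (T : measurableType d) (R : realType) (P : probability T R).
Local Open Scope ereal_scope.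

(** On subsets of [g < f] the integrals of [f] and [g] bound each other, so [f = g] almost
    everywhere there, which leaves only a null set. *)
Lemma integral_le_ae (f g : T -> \bar R) :
  P.-integrable setT f -> P.-integrable setT g ->
  (forall A, measurable A -> \int[P]_(x in A) f x <= \int[P]_(x in A) g x) ->
  P [set x | g x < f x] = 0.
Proof.
move=> intf intg fg.
have mf := measurable_int _ intf; have mg := measurable_int _ intg.
have mD : measurable [set x | g x < f x].
  by rewrite -[X in measurable X]setTI; exact: measurable_lte.
have : ae_eq P [set x | g x < f x] f g.
  apply: integral_ae_eq => //.
  - exact: integrableS intf.
  - exact: measurable_funTS.
  move=> E ED mE; apply/eqP; rewrite eq_le fg//=.
  apply: le_integral => //.
  - exact: integrableS intg.
  - exact: integrableS intf.
  - by move=> x /set_mem /ED /ltW.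
move=> [N [mN N0 subN]]; apply/eqP; rewrite -measure_le0 -N0.
apply: le_measure; rewrite ?inE// => x /= gf; apply: subN => /= /(_ gf) e.
by move: gf; rewrite e ltxx.
Qed.

(** The Radon-Nikodym derivative exceeds 1 only on a null set, so truncating it at 1 gives a version
    bounded everywhere. *)
Lemma density_le1 (nu : {finite_measure set T -> \bar R}) :
  (forall A, measurable A -> nu A <= P A) ->
  exists f : T -> \bar R, [/\ measurable_fun setT f, (forall x, 0 <= f x <= 1) &
    forall A, measurable A -> nu A = \int[P]_(x in A) f x].
Proof.
move=> nuP.
have dom : nu `<< P.
  apply/null_content_dominatesP => A mA PA0; apply/eqP.
  by rewrite -measure_le0 -PA0 nuP.
have [f [f0 intf nuE]] := radon_nikodym_finite dom.
have mf := measurable_int _ intf.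
have mf1 : measurable_fun setT (fun x => mine (f x) 1).
  by apply: measurable_mine => //; exact: measurable_cst.
exists (fun x => mine (f x) 1); split => //.
- by move=> x; rewrite le_min f0 lee01 ge_min lexx orbT.
have int1 : P.-integrable setT (cst 1) by exact: finite_measure_integrable_cst.
have D0 : P [set x | (cst 1) x < f x] = 0.
  apply: integral_le_ae => // A mA; rewrite -nuE// integral_cst//= mul1e.
  exact: nuP.
move=> A mA; rewrite nuE//; apply: ae_eq_integral => //.
- exact: measurable_funTS.
- exact: measurable_funTS.
exists [set x | (cst 1) x < f x]; split => //.
  by rewrite -[X in measurable X]setTI; exact: measurable_lte.
move=> x /= h; rewrite ltNge; apply/negP => f1; apply: h => _.
by rewrite min_l.
Qed.

End comparison.

(** * Conditional quantiles *)

Section quantile.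
Context (R : realType) d (A : measurableType d) (gamma : probability (A * R)%type R).
Hypothesis supp : gamma [set p | ~~ (0 <= p.2 <= 1)] = 0%E.

Let alpha : probability A R := law gamma measurable_fst.

Lemma conditional_density (S : set (A * R)) : measurable S ->
  exists f : A -> \bar R, [/\ measurable_fun setT f, (forall a, 0 <= f a <= 1)%E &
    forall B, measurable B ->
      gamma (S `&` fst @^-1` B) = \int[alpha]_(a in B) f a]%E.
Proof.
move=> mS; have mfst : measurable_fun setT (@fst A R) := measurable_fst.
have [|f [mf f01 fE]] := @density_le1 _ _ _ alpha (rlaw gamma mS mfst).
  by move=> B mB; exact: rlaw_le.
by exists f; split => // B mB; rewrite -fE.
Qed.

Lemma measurable_snd_le (q : R) : measurable [set p : A * R | p.2 <= q].
Proof.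
rewrite (_ : [set p | _] = snd @^-1` `]-oo, q]).
  exact: measurable_preimageT measurable_snd (measurable_itv _).
by apply/seteqP; split => p /=; rewrite in_itv.
Qed.

Lemma measurable_snd_lt (q : R) : measurable [set p : A * R | p.2 < q].
Proof.
rewrite (_ : [set p | _] = snd @^-1` `]-oo, q[).
  exact: measurable_preimageT measurable_snd (measurable_itv _).
by apply/seteqP; split => p /=; rewrite in_itv.
Qed.

Variable F : rat -> A -> \bar R.
Hypothesis mF : forall q, measurable_fun setT (F q).
Hypothesis F01 : forall q a, (0 <= F q a <= 1)%E.
Hypothesis FE : forall q B, measurable B ->
  gamma ([set p | p.2 <= ratr q] `&` fst @^-1` B) = (\int[alpha]_(a in B) F q a)%E.

(** Each [F q] is just some version of the conditional probability that the second coordinate is at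
    most [q]; monotonicity in [q] may fail, but the infimum is monotone in [u] all the same. The
    point 1 makes the set nonempty and [0 <= q] bounds it below. *)
Definition quantile_set (a : A) (u : I01M R) : set R :=
  [set 1] `|` [set ratr q | q in [set q : rat | 0 <= q /\ ((ival u)%:E <= F q a)%E]].

Definition quantile (p : A * I01M R) : R := inf (quantile_set p.1 p.2).

Lemma quantile_set_neq0 a u : quantile_set a u !=set0.
Proof. by exists 1; left. Qed.

Lemma quantile_set_ge0 a u : lbound (quantile_set a u) 0.
Proof. by move=> x [->|[q [q0 _] <-]] //; rewrite ler0q. Qed.

(** The strict inequality turns the infimum into a countable union, which gives both measurability
    and the comparison with [F]. *)
Lemma quantile_lt p s : quantile p < s <->
  1 < s \/ exists q : rat, [/\ 0 <= q, ratr q < s & ((ival p.2)%:E <= F q p.1)%E].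
Proof.
have hl : has_lbound (quantile_set p.1 p.2).
  by exists 0; exact: quantile_set_ge0.
split.
  move=> /(inf_lt (quantile_set_neq0 _ _)) [x [->|[q [q0 uq] <-]] xs]; first by left.
  by right; exists q.
move=> [s1|[q [q0 qs uq]]].
  by apply: le_lt_trans s1; apply: (ge_inf hl); left.
by apply: le_lt_trans qs; apply: (ge_inf hl); right; exists q.
Qed.

Lemma quantile_mono a u v : ival u <= ival v -> quantile (a, u) <= quantile (a, v).
Proof.
move=> uv; rewrite leNgt; apply/negP => /quantile_lt[s1|[q [q0 qs vq]]].
  have : quantile (a, u) <= 1.
    by apply: ge_inf; [exists 0; exact: quantile_set_ge0|left].
  by rewrite leNgt s1.
suff : quantile (a, u) < quantile (a, u) by rewrite ltxx.
apply/quantile_lt; right; exists q; split => //.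
by rewrite (le_trans _ vq)// lee_fin.
Qed.

Lemma measurable_quantile_lt s : measurable [set p | quantile p < s].
Proof.
have -> : [set p | quantile p < s] = [set _ | 1 < s] `|`
   \bigcup_q ([set p | ((ival p.2)%:E <= F q p.1)%E] `&` [set _ | 0 <= q /\ ratr q < s]).
  apply/seteqP; split => p /=; rewrite quantile_lt.
    by move=> [s1|[q [q0 qs uq]]]; [left|right; exists q].
  by move=> [s1|[q _ [/= uq [q0 qs]]]]; [left|right; exists q].
have mcst (Q : Prop) : measurable [set _ : A * I01M R | Q].
  have [h|h] := pselect Q.
    by rewrite (_ : [set _ | _] = setT)//; apply/seteqP; split.
  by rewrite (_ : [set _ | _] = set0)//; apply/seteqP; split.
apply: measurableU; first exact: mcst.
apply: bigcupT_measurable_rat => q; apply: measurableI; last exact: mcst.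
rewrite -[X in measurable X]setTI; apply: measurable_lee => //.
  apply/measurable_EFinP.
  exact: (measurableT_comp (@measurable_ival R) measurable_snd).
exact: (measurableT_comp (mF q) measurable_fst).
Qed.

Lemma measurable_quantile : measurable_fun setT quantile.
Proof.
apply: (measurability _ (RGenInftyO.measurableE R)) => //.
move=> _ [_ [s ->] <-]; rewrite setTI.
rewrite (_ : _ @^-1` _ = [set p | quantile p < s]); first exact: measurable_quantile_lt.
by apply/seteqP; split => p /=; rewrite in_itv.
Qed.

Let Lam (s : R) (a : A) : \bar R := lam R [set u | quantile (a, u) < s].

Let mLam s : measurable_fun setT (Lam s).
Proof. exact: (measurable_fun_section (lam R) (measurable_quantile_lt s)). Qed.

Let mLamset s a : measurable [set u | quantile (a, u) < s].
Proof. exact: measurable_section a (measurable_quantile_lt s). Qed.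

Let supp_lt B s : measurable B -> s <= 0 ->
  gamma ([set p | p.2 < s] `&` fst @^-1` B) = 0%E.
Proof.
move=> mB s0; apply: measure0_sub supp.
- by apply: measurableI; [exact: measurable_snd_lt|exact: measurable_preimageT].
- rewrite (_ : [set p | _] = ~` (snd @^-1` `[0, 1])).
    apply: measurableC.
    exact: measurable_preimageT measurable_snd (measurable_itv _).
  by apply/seteqP; split => p /=; rewrite in_itv /= => /negP.
- move=> p [/= ps _]; rewrite negb_and -!ltNge.
  by rewrite (lt_le_trans ps s0).
Qed.

Let m_supp : measurable [set p : A * R | 0 <= p.2 <= 1].
Proof.
rewrite (_ : [set p | _] = snd @^-1` `[0, 1]).
  exact: measurable_preimageT measurable_snd (measurable_itv _).
by apply/seteqP; split => p /=; rewrite in_itv.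
Qed.

Let supp' : gamma (~` [set p | 0 <= p.2 <= 1]) = 0%E.
Proof.
by rewrite -supp; congr (gamma _); apply/seteqP; split => p /= /negP.
Qed.

(** Let [G] be the conditional probability of [p.2 < s]. Outside one null set [F q <= G] for all
    rational [q < s], so a quantile below [s] forces [u <= G], an event of probability [G]. The
    bound [s <= 1] excludes the default point 1 of [quantile_set]. *)
Let upper B s : measurable B -> s <= 1 ->
  (\int[alpha]_(a in B) Lam s a <= gamma ([set p | (p.2 < s)%R] `&` fst @^-1` B))%E.
Proof.
move=> mB s1.
have [G [mG G01 GE]] := conditional_density (measurable_snd_lt s).
rewrite GE//.
have intG : alpha.-integrable setT G by exact: integrable_bounded.
have intF q : alpha.-integrable setT (F q) by exact: integrable_bounded.
pose N n := if @unpickle rat n is Some q then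
  (if ratr q < s then [set a | (G a < F q a)%E] else set0) else set0.
have mltN q : measurable [set a | (G a < F q a)%E].
  by rewrite -[X in measurable X]setTI; exact: measurable_lte.
have mN n : measurable (N n).
  by rewrite /N; case: unpickle => // q; case: ifP.
have N0 : alpha.-negligible (\bigcup_n N n).
  apply: negligible_bigcup => n; rewrite /N; case: unpickle => [q|]; last first.
    exact: negligible_set0.
  case: ifP => [qs|_]; last exact: negligible_set0.
  apply/negligibleP; first exact: mltN.
  apply: integral_le_ae => // C mC; rewrite -FE// -GE//.
  have mfC : measurable (@fst A R @^-1` C) by exact: measurable_preimageT.
  apply: le_measure; rewrite ?inE.
  - by apply: measurableI => //; exact: measurable_snd_le.
  - by apply: measurableI => //; exact: measurable_snd_lt.
  - by move=> p [/= pq Cp]; split => //=; exact: le_lt_trans qs.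
apply: ae_ge0_le_integral => //.
- exact: measurable_funTS.
- by move=> a _; case/andP: (G01 a).
- exact: measurable_funTS.
apply: negligibleS N0 => a /= h; apply: contrapT => Na; apply: h => _.
rewrite -(lam_le (G01 a)); apply: le_measure; rewrite ?inE//.
  rewrite -[X in measurable X]setTI; apply: measurable_lee => //.
  by apply/measurable_EFinP; exact: measurable_ival.
move=> u /= /quantile_lt[|[q [q0 qs uq]]]; first by rewrite ltNge s1.
rewrite (le_trans uq)// leNgt; apply/negP => Gq; apply: Na.
by exists (pickle q); [by []|rewrite /N pickleK qs].
Qed.

(** The event [p.2 < s] is exhausted by [p.2 <= s - 1/(n+1)]. A rational [q] between the two
    thresholds is admissible in [quantile_set], so [u <= F q] makes the quantile smaller than
    [s]. *)
Let lower B s : measurable B ->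
  (gamma ([set p | (p.2 < s)%R] `&` fst @^-1` B) <= \int[alpha]_(a in B) Lam s a)%E.
Proof.
move=> mB; have mfB : measurable (@fst A R @^-1` B) by exact: measurable_preimageT.
pose E n := [set p : A * R | p.2 <= s - n.+1%:R^-1] `&` fst @^-1` B.
have mE n : measurable (E n).
  by apply: measurableI => //; exact: measurable_snd_le.
have UE : [set p | p.2 < s] `&` fst @^-1` B = \bigcup_n E n.
  apply/seteqP; split => [p [/= ps Bp]|p [n _ [/= pn Bp]]]; last first.
    by split => //=; rewrite (le_lt_trans pn)// ltrBlDr ltrDl invr_gt0.
  have [n pn] := ltr_add_invr ps.
  by exists n => //; split => //=; rewrite lerBrDr ltW.
have ndE : nondecreasing_seq E.
  move=> m n mn; apply/subsetPset => p [/= pm Bp]; split => //=.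
  rewrite (le_trans pm)// lerD2l lerN2 lef_pV2 ?posrE ?ltr0n//.
  by rewrite ler_nat ltnS.
have mUE : measurable (\bigcup_n E n) by exact: bigcupT_measurable.
have cvE := @nondecreasing_cvg_mu _ _ _ gamma E mE mUE ndE.
rewrite UE -(cvg_lim _ cvE)//; apply: lime_le; first by apply: cvgP; exact: cvE.
near=> n => /=.
have [q] : exists q, ratr q \in `]s - n.+1%:R^-1, s[.
  by apply: rat_in_itvoo; rewrite ltrBlDr ltrDl invr_gt0.
rewrite in_itv /= => /andP[nq qs].
(* A negative [q] is not allowed in [quantile_set], but then [E n] lies in [p.2 < 0], which is null
   by [supp]. *)
have [q0|q0] := ltP q 0.
  rewrite (_ : gamma _ = 0%E); last first.
    have mlt := measurable_snd_lt 0.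
    apply: (measure0_sub (mE n) _ _ (supp_lt mB (lexx 0))).
      exact: measurableI.
    move=> p [/= pn Bp]; split => //=; rewrite (le_lt_trans pn)//.
    by rewrite (lt_trans nq)// ltrq0.
  by apply: integral_ge0 => a _; exact: measure_ge0.
apply: (@le_trans _ _ (gamma ([set p | p.2 <= ratr q] `&` fst @^-1` B))).
  apply: le_measure; rewrite ?inE//.
    by apply: measurableI => //; exact: measurable_snd_le.
  by move=> p [/= pn Bp]; split => //=; rewrite (le_trans pn)// ltW.
rewrite FE//; apply: ge0_le_integral => //.
- by move=> a _; case/andP: (F01 q a).
- exact: measurable_funTS.
- exact: (measurable_funTS (mLam s)).
move=> a _; rewrite -(lam_le (F01 q a)); apply: le_measure; rewrite ?inE//.
  rewrite -[X in measurable X]setTI; apply: measurable_lee => //.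
  by apply/measurable_EFinP; exact: measurable_ival.
by move=> u /= uq; apply/quantile_lt; right; exists q.
Unshelve. all: by end_near. Qed.

Lemma quantile_ray B s : measurable B ->
  pprod alpha (lam R) ([set p | quantile p < s] `&` fst @^-1` B) =
  gamma ([set p | p.2 < s] `&` fst @^-1` B).
Proof.
move=> mB; rewrite pprodE_fst//; last exact: measurable_quantile_lt.
apply/eqP; rewrite eq_le lower// andbT; have [s1|s1] := leP s 1; first exact: upper.
have mfB : measurable (@fst A R @^-1` B) by exact: measurable_preimageT.
(* For [1 < s] the constraint on the second coordinate holds almost surely, and the bound of a
   probability by 1 suffices. *)
rewrite [leRHS](_ : _ = gamma (@fst A R @^-1` B)); last first.
  rewrite (measureI_full mfB m_supp supp').
  rewrite [LHS](measureI_full _ m_supp supp').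
    congr (gamma _); apply/seteqP; split => p /=.
      by move=> [[? ?] ?].
    move=> [Bp /andP[p0 p1]]; split; last by rewrite p0.
    by split => //; exact: le_lt_trans s1.
  by apply: measurableI => //; exact: measurable_snd_lt.
rewrite (_ : gamma _ = \int[alpha]_(a in B) 1)%E; last first.
  by rewrite integral_cst//= mul1e.
apply: ge0_le_integral => //; first exact: (measurable_funTS (mLam s)).
by move=> a _; apply: probability_le1; exact: (mLamset s a).
Qed.

Lemma quantile_law :
  same_law (pprod alpha (lam R)) (fun p => (p.1, quantile p)) gamma id.
Proof.
have -> : id = (fun p : A * R => (p.1, p.2)) by apply/funext => -[].
apply: same_law_pair => //; first exact: measurable_quantile.
move=> B C mB mC; rewrite [in LHS]setIC [in RHS]setIC.
have m1 : measurable (@fst A (I01M R) @^-1` B) by exact: measurable_preimageT.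
have m2 : measurable (@fst A R @^-1` B) by exact: measurable_preimageT.
have msnd : measurable_fun setT (@snd A R) := measurable_snd.
have mq := measurable_quantile.
rewrite [in LHS]setIC [in RHS]setIC.
(* For fixed [B] both sides are finite measures in [C], so it is enough to compare them on open
   rays. *)
change (rlaw (pprod alpha (lam R)) m1 mq C = rlaw gamma m2 msnd C).
apply: (measure_unique (@RGenInftyO.G R) (fun n => `]-oo, n%:R[%classic)) => //.
- exact: (RGenInftyO.measurableE R).
- move=> _ _ [x ->] [y ->]; exists (Num.min x y).
  by apply/seteqP; split => z /=; rewrite !in_itv /= lt_min => /andP.
- by move=> n; exists n%:R.
- apply/seteqP; split => // x _; exists (Num.truncn x).+1 => //=.
  by rewrite in_itv/= truncnS_gt.
- move=> _ [x ->].
  have := quantile_ray x mB; rewrite ![_ `&` fst @^-1` B]setIC => h.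
  apply: etrans; [|apply: etrans; [exact: h|]]; rewrite /rlaw; congr (_ (_ `&` _));
    by apply/seteqP; split => p /=; rewrite in_itv.
- move=> n; rewrite (le_lt_trans (rlaw_le _ _ _ _))// ?(le_lt_trans (probability_le1 _ _)) ?ltry//.
Qed.

End quantile.

(** Monotonicity in the noise is recorded because it later allows the noise to be recovered from the
    value by a distribution function. *)
Lemma monotone_randomization (R : realType) d (A : measurableType d)
  (gamma : probability (A * R)%type R) :
  gamma [set p | ~~ (0 <= p.2 <= 1)] = 0%E ->
  exists Q : A * I01M R -> R, [/\ measurable_fun setT Q,
    (forall a u v, ival u <= ival v -> Q (a, u) <= Q (a, v)) &
    same_law (pprod (law gamma measurable_fst) (lam R)) (fun p => (p.1, Q p)) gamma id].
Proof.
move=> supp.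
have /choice[F HF] (q : rat) := conditional_density gamma (@measurable_snd_le R d A (ratr q)).
have mF q : measurable_fun setT (F q) by have [] := HF q.
have F01 q a : (0 <= F q a <= 1)%E by have [_ h _] := HF q; exact: h.
exists (quantile F); split.
- exact: measurable_quantile.
- by move=> a u v; exact: quantile_mono.
- by apply: quantile_law => // q B mB; have [_ _] := HF q; exact.
Qed.

(** * Randomization and uniformization *)

Lemma measurable_eqR (R : realType) d (A : measurableType d) (f g : A -> R) :
  measurable_fun setT f -> measurable_fun setT g -> measurable [set x | f x = g x].
Proof.
move=> mf mg; rewrite (_ : [set x | _] = (f \- g) @^-1` [set 0]).
  exact: (measurable_preimageT (measurable_funB mf mg)).
by apply/seteqP; split => x /=; [move=> ->; rewrite subrr|move/eqP; rewrite subr_eq0 => /eqP].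
Qed.

Lemma measurable_eq_standard (R : realType) d d' (A : measurableType d)
  (E : measurableType d') (f g : A -> E) : standard R E ->
  measurable_fun setT f -> measurable_fun setT g -> measurable [set x | f x = g x].
Proof.
move=> [c [dec [mc mdec cK _]]] mf mg.
rewrite (_ : [set x | _] = [set x | c (f x) = c (g x)]).
  by apply: measurable_eqR; exact: (measurableT_comp mc).
by apply/seteqP; split => x /= => [->//|/(f_equal dec)]; rewrite !cK.
Qed.

Section real_uniformization.
Context (R : realType) d (A : measurableType d) (gamma : probability (A * R)%type R).
Hypothesis atomless : forall g : A -> R, measurable_fun setT g ->
  gamma [set p | p.2 = g p.1] = 0%E.

Let alpha : probability A R := law gamma measurable_fst.

Variable Q : A * I01M R -> R.
Hypothesis mQ : measurable_fun setT Q.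
Hypothesis Qmono : forall a u v, ival u <= ival v -> Q (a, u) <= Q (a, v).
Hypothesis Qlaw : same_law (pprod alpha (lam R)) (fun p => (p.1, Q p)) gamma id.

Let mQu u : measurable_fun setT (fun a => Q (a, u)).
Proof. exact: (measurableT_comp mQ (pair2_measurable u)). Qed.

(** By monotonicity these are the [a] for which [Q (a, .)] is constant between the two rationals. *)
Let flat (r r' : rat) : set A :=
  [set a | Q (a, iclamp (ratr r)) = Q (a, iclamp (ratr r'))].

Let mflat r r' : measurable (flat r r').
Proof. exact: measurable_eqR. Qed.

Let lerq1 (r : rat) : (ratr r <= 1 :> R) = (r <= 1).
Proof. by rewrite -(ler_rat R) rmorph1. Qed.

Let iclampK (r : rat) : 0 <= r <= 1 -> ival (iclamp (ratr r : R)) = ratr r.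
Proof. by move=> r01; rewrite ival_iclamp ler0q lerq1 r01. Qed.

(** On a flat stretch the conditional law has an atom of mass at least [r' - r], located at a
    measurable function of [a]; [atomless] rules this out unless the set of such [a] is null. *)
Let flat0 (r r' : rat) : 0 <= r -> r < r' -> r' <= 1 -> alpha (flat r r') = 0%E.
Proof.
move=> r0 rr' r1.
have mg := mQu (iclamp (ratr r)).
pose B := [set p : A * R | p.2 = Q (p.1, iclamp (ratr r))].
have mB : measurable B.
  apply: measurable_eqR => //; exact: (measurableT_comp mg measurable_fst).
have B0 := etrans (Qlaw mB) (atomless mg).
pose J := [set u : I01M R | ratr r <= ival u <= ratr r'].
have mJ : measurable J.
  rewrite (_ : J = @ival R @^-1` `[ratr r, ratr r']).
    exact: measurable_preimageT (@measurable_ival R) (measurable_itv _).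
  by apply/seteqP; split => u /=; rewrite in_itv.
have : pprod alpha (lam R) (flat r r' `*` J) = 0%E.
  apply: measure0_sub B0.
  - exact: measurableX.
  - apply: measurable_preimageT mB; exact: measurable_fun_pair.
  - move=> [a u] [/= fa /andP[ru ur']]; rewrite /B /=.
    apply/eqP; rewrite eq_le; apply/andP; split.
      rewrite fa; apply: Qmono; rewrite iclampK//.
      by rewrite (le_trans r0 (ltW rr')) r1.
    by apply: Qmono; rewrite iclampK// r0 (le_trans (ltW rr') r1).
rewrite pprodX// lam_itv ?ler0q ?ler_rat ?lerq1//; last exact: ltW.
move/eqP; rewrite mule_eq0 => /orP[/eqP//|].
by rewrite eqe subr_eq0 eq_le ler_rat leNgt rr'.
Qed.

Let bad : set A := \bigcup_n
  (if @unpickle (rat * rat)%type n is Some (r, r') then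
     if [&& 0 <= r, r < r' & r' <= 1] then flat r r' else set0
   else set0).

Let mbad : measurable bad.
Proof.
apply: bigcupT_measurable => n; case: unpickle => [[r r']|] //.
by case: ifP => // _; exact: mflat.
Qed.

Let bad0 : alpha bad = 0%E.
Proof.
apply/negligibleP => //; apply: negligible_bigcup => n.
case: unpickle => [[r r']|]; last exact: negligible_set0.
case: ifP => [/and3P[r0 rr' r1]|_]; last exact: negligible_set0.
by apply/negligibleP; [exact: mflat|exact: flat0].
Qed.

Let Qstrict a u v : ~ bad a -> ival u < ival v -> Q (a, u) < Q (a, v).
Proof.
move=> na uv.
have [r'] := rat_in_itvoo uv; rewrite in_itv /= => /andP[ur' r'v].
have [r] := rat_in_itvoo ur'; rewrite in_itv /= => /andP[ur rr'].
have /andP[u0 _] := ival_bound u; have /andP[_ v1] := ival_bound v.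
have r0 : 0 <= r by rewrite -(ler0q R) (le_trans u0)// ltW.
have r'1 : r' <= 1 by rewrite -lerq1 (le_trans _ v1)// ltW.
rewrite ltr_rat in rr'.
have r01 : 0 <= r <= 1 by rewrite r0 (le_trans (ltW rr') r'1).
have r'01 : 0 <= r' <= 1 by rewrite r'1 (le_trans r0 (ltW rr')).
apply: (@le_lt_trans _ _ (Q (a, iclamp (ratr r)))).
  by apply: Qmono; rewrite iclampK// ltW.
apply: (@lt_le_trans _ _ (Q (a, iclamp (ratr r')))); last first.
  by apply: Qmono; rewrite iclampK// ltW.
rewrite lt_neqAle Qmono ?andbT; last by rewrite !iclampK// ler_rat ltW.
apply/negP => /eqP e; apply: na; exists (pickle (r, r')); first by [].
by rewrite pickleK r0 rr' r'1.
Qed.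

Let below := [set p : A * R * I01M R | Q (p.1.1, p.2) <= p.1.2].

Let mbelow : measurable below.
Proof.
have m1 : measurable_fun setT (fun p : A * R * I01M R => Q (p.1.1, p.2)).
  apply: (measurableT_comp mQ); apply: measurable_fun_pair => //.
  exact: (measurableT_comp measurable_fst measurable_fst).
have m2 : measurable_fun setT (fun p : A * R * I01M R => p.1.2).
  exact: (measurableT_comp measurable_snd measurable_fst).
have := measurable_preimageT (measurable_fun_ler m1 m2) (B := [set true]).
by apply.
Qed.

(** The probability integral transform: the distribution function of the conditional law given
    [p.1], expressed through its randomization [Q] and evaluated at the observed value [p.2]. *)
Definition cond_cdf (p : A * R) : I01M R :=
  iclamp (fine (lam R [set w | Q (p.1, w) <= p.2])).

Lemma measurable_cond_cdf : measurable_fun setT cond_cdf.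
Proof.
apply: (measurableT_comp (@measurable_iclamp R)).
apply: (measurableT_comp (fine_measurable measurableT)) => //.
exact: (measurable_fun_section (lam R) mbelow).
Qed.

(** Off [bad], [Q (a, .)] is strictly increasing, so [Q (a, w) <= Q (a, u)] means [w <= u], an event
    of probability [u]. *)
Let cond_cdfK a u : ~ bad a -> cond_cdf (a, Q (a, u)) = u.
Proof.
move=> na; rewrite /cond_cdf /=.
rewrite (_ : [set w | _] = [set w | ((ival w)%:E <= (ival u)%:E)%E]).
  by rewrite lam_le /= ?ivalK// !lee_fin ival_bound.
apply/seteqP; split => w /=; rewrite lee_fin; last exact: Qmono.
by move=> h; rewrite leNgt; apply/negP => /(Qstrict na); rewrite ltNge h.
Qed.

Let mnbad d' (T : measurableType d') : measurable (@fst A T @^-1` (~` bad)).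
Proof. by apply: measurable_preimageT => //; exact: measurableC. Qed.

Let nbad0 : pprod alpha (lam R) (~` (fst @^-1` (~` bad))) = 0%E.
Proof.
rewrite (_ : ~` _ = bad `*` setT).
  by rewrite pprodX// bad0 mul0e.
by apply/seteqP; split => p /=; [move/contrapT|move=> [? _]; exact].
Qed.

(** By [Qlaw] a pair of law [gamma] may be replaced by [(a, Q (a, u))] with [u] uniform, and
    [cond_cdf] returns [u] there almost surely. The next lemma rests on the same substitution. *)
Lemma cond_cdf_law :
  same_law gamma (fun p => (p.1, cond_cdf p)) (pprod alpha (lam R)) id.
Proof.
have mF := measurable_cond_cdf.
have mg : measurable_fun setT (fun p : A * R => (p.1, cond_cdf p)).
  exact: measurable_fun_pair.
have mpQ : measurable_fun setT (fun p : A * I01M R => (p.1, Q p)).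
  exact: measurable_fun_pair.
apply: same_law_trans (same_law_sym (same_law_comp mg Qlaw)) _.
have mnb : measurable (@fst A (I01M R) @^-1` (~` bad)) := @mnbad _ _.
apply: (same_law_ae (P := pprod alpha (lam R)) _ _ mnb nbad0).
- exact: (measurableT_comp mg mpQ).
- exact: measurable_id.
by move=> [a u] /set_mem /= na; rewrite /= cond_cdfK.
Qed.

Lemma cond_cdf_inverse : gamma (~` [set p | Q (p.1, cond_cdf p) = p.2]) = 0%E.
Proof.
have mF := measurable_cond_cdf.
have mD : measurable (~` [set p | Q (p.1, cond_cdf p) = p.2]).
  apply: measurableC; apply: measurable_eqR => //.
  by apply: (measurableT_comp mQ); exact: measurable_fun_pair.
rewrite -[LHS](Qlaw mD); apply: measure0_sub nbad0.
- by apply: measurable_preimageT mD; exact: measurable_fun_pair.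
- by apply: measurableC; exact: mnbad.
- by move=> [a u] /= h na; apply: h; rewrite cond_cdfK.
Qed.

End real_uniformization.

Section randomization.
Context (R : realType) d dA dE (T : measurableType d) (A : measurableType dA)
  (E : measurableType dE) (P : probability T R) (a : T -> A) (e : T -> E).
Hypothesis ma : measurable_fun setT a.
Hypothesis me : measurable_fun setT e.
Hypothesis sE : standard R E.

Let code_law (c : E -> R) (mc : measurable_fun setT c) :
  measurable_fun setT (fun w => (a w, c (e w))).
Proof. by apply: measurable_fun_pair => //; exact: (measurableT_comp mc). Qed.

Let supp_law (c : E -> R) (mc : measurable_fun setT c) :
  (forall x, 0 <= c x <= 1) ->
  law P (code_law mc) [set p | ~~ (0 <= p.2 <= 1)] = 0%E.
Proof.
move=> c01; rewrite /law /pushforward (_ : _ @^-1` _ = set0) ?measure0//.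
by rewrite -subset0 => w /=; rewrite c01.
Qed.

Let base_law (c : E -> R) (mc : measurable_fun setT c) :
  same_law (pprod P (lam R)) (fun p => (a p.1, p.2))
    (pprod (law (law P (code_law mc)) measurable_fst) (lam R)) (fun p => (p.1, p.2)).
Proof. exact: (same_law_noise (lam R) (f1 := a) (f2 := id)). Qed.

(** Noise outsourcing: the quantile of a real code of [e] given [a] is decoded back to [E]. *)
Lemma randomization : exists q : A * I01M R -> E, measurable_fun setT q /\
  same_law (pprod P (lam R)) (fun p => (a p.1, q (a p.1, p.2)))
    P (fun w => (a w, e w)).
Proof.
have [c [dec [mc mdec cK c01]]] := sE.
have [Q [mQ _ Qlaw]] := monotone_randomization (supp_law mc c01).
exists (fun p => dec (Q p)); have mq := measurableT_comp mdec mQ.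
split; first exact: mq.
have mg : measurable_fun setT (fun p : A * I01M R => (p.1, Q p)).
  exact: measurable_fun_pair.
have mh : measurable_fun setT (fun p : A * R => (p.1, dec p.2)).
  by apply: measurable_fun_pair => //; exact: (measurableT_comp mdec).
have h := same_law_trans (same_law_comp mg (base_law mc)) Qlaw.
move=> B mB; apply: etrans (same_law_comp mh h mB) _.
rewrite /law /pushforward /=; congr (P _); apply/seteqP.
by split => w /=; rewrite cK.
Qed.

(** The hypothesis says, by means of graphs, that the conditional law of [e] given [a] has no atoms.
    A code of [e] inherits this property, since a graph hit by the code is hit by [e] after
    decoding, and [cond_cdf] applies to the code. *)
Lemma uniformization :
  (forall g : A -> E, measurable_fun setT g -> P [set w | e w = g (a w)] = 0%E) ->
  exists (F : A * E -> I01M R) (Q : A * I01M R -> E),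
    [/\ measurable_fun setT F, measurable_fun setT Q,
        same_law P (fun w => (a w, F (a w, e w)))
          (pprod P (lam R)) (fun p => (a p.1, p.2)) &
        P (~` [set w | Q (a w, F (a w, e w)) = e w]) = 0%E].
Proof.
move=> atomless.
have [c [dec [mc mdec cK c01]]] := sE.
have supp := supp_law mc c01.
have [Q [mQ Qmono Qlaw]] := monotone_randomization supp.
have atomless' g : measurable_fun setT g ->
    law P (code_law mc) [set p | p.2 = g p.1] = 0%E.
  move=> mg; have mdg := measurableT_comp mdec mg.
  apply: measure0_sub (atomless _ mdg).
  - apply: measurable_eqR; first exact: (measurableT_comp mc).
    exact: (measurableT_comp mg).
  - apply: (measurable_eq_standard sE) => //; exact: (measurableT_comp mdg ma).
  - by move=> w /= <-; rewrite cK.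
have mF : measurable_fun setT (cond_cdf Q) by apply: measurable_cond_cdf.
exists (fun p => cond_cdf Q (p.1, c p.2)), (fun p => dec (Q p)); split.
- apply: (measurableT_comp mF); apply: measurable_fun_pair => //.
  exact: (measurableT_comp mc).
- exact: (measurableT_comp mdec).
- move=> B mB; have := cond_cdf_law atomless' mQ Qmono Qlaw mB.
  rewrite [in X in _ = X -> _](_ : id = fun p : A * I01M R => (p.1, p.2)); last first.
    by apply/funext => -[].
  by move=> h; rewrite [RHS](base_law mc mB) -h.
have h := cond_cdf_inverse atomless' mQ Qmono Qlaw.
have mD : measurable [set p : A * R | Q (p.1, cond_cdf Q p) = p.2].
  apply: measurable_eqR => //.
  by apply: (measurableT_comp mQ); exact: measurable_fun_pair.
have mL := code_law mc.
pose N := ~` [set p : A * R | Q (p.1, cond_cdf Q p) = p.2].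
apply: (measure0_sub (B := (fun w => (a w, c (e w))) @^-1` N)) => //.
- apply: measurableC; apply: (measurable_eq_standard sE) => //.
  apply: (measurableT_comp mdec); apply: (measurableT_comp mQ).
  apply: measurable_fun_pair => //; exact: (measurableT_comp mF mL).
- by apply: measurable_preimageT mL _; exact: measurableC.
- by move=> w /= h1 h2; apply: h1; rewrite h2 cK.
Qed.

End randomization.

(** * Splitting a uniform noise, and codes inside a null set *)

Section noise_tools.
Variable R : realType.
Local Notation I := (I01M R).
Local Notation lam := (lam R).

Lemma I01_standard : standard R I.
Proof. exact: bitcoded_standard (I01_bitcoded R). Qed.

(** A pair of independent uniform variables is randomized over a trivial conditioning variable. *)
Lemma noise_splitting : exists p1 p2 : I -> I,
  [/\ measurable_fun setT p1, measurable_fun setT p2 &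
      same_law lam (fun u => (p1 u, p2 u)) (pprod lam lam) id].
Proof.
have sI : standard R (I * I)%type.
  by apply: bitcoded_standard; apply: bitcoded_prod; exact: I01_bitcoded.
have mtt : measurable_fun setT (fun _ : I * I => tt) by exact: measurable_cst.
have [q [mq ql]] :=
  randomization (pprod lam lam) mtt (@measurable_id _ (I * I)%type setT) sI.
have mqt : measurable_fun setT (fun u => q (tt, u)).
  exact: (measurableT_comp mq (pair1_measurable tt)).
exists (fun u => (q (tt, u)).1), (fun u => (q (tt, u)).2); split.
- exact: (measurableT_comp measurable_fst mqt).
- exact: (measurableT_comp measurable_snd mqt).
move=> B mB; have := same_law_comp measurable_snd ql mB => /= <-.
rewrite (_ : _ @^-1` _ = setT `*` ((fun u => q (tt, u)) @^-1` B)).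
  rewrite pprodX ?probability_setT ?mul1e//; last exact: measurable_preimageT.
  by congr (lam _); apply/seteqP; split => u /=; case: (q _).
by apply/seteqP; split => p /= => [|[]].
Qed.

(** The product of the unit interval with [E] is coded in the unit interval. For each [a] the codes
    of the pairs [(a, e)] lie in the fibre of [r] with [(D r).1 = a]; by Fubini on a graph some
    fibre is null, and it contains a copy of [E]. *)
Lemma null_code d (E : measurableType d) : bitcoded R E ->
  exists (K : set I) (c : E -> I) (dec : I -> E),
    [/\ measurable K, lam K = 0%E, measurable_fun setT c, measurable_fun setT dec &
        cancel c dec /\ forall e, K (c e)].
Proof.
move=> bE.
have [c [dec [mc mdec cK c01]]] :=
  bitcoded_standard (bitcoded_prod (I01_bitcoded R) bE).
pose D r := dec (ival r).
have mD : measurable_fun setT D by exact: (measurableT_comp mdec (@measurable_ival R)).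
have mD1 : measurable_fun setT (fun r => (D r).1).
  exact: (measurableT_comp measurable_fst mD).
pose G := [set p : I * I | (D p.1).1 = p.2].
have mG : measurable G.
  apply: (measurable_eq_standard I01_standard) => //.
  exact: (measurableT_comp mD1).
have G0 : pprod lam lam G = 0%E.
  rewrite pprodE; apply: integral0_eq => r _; rewrite -[RHS](lam_eq (ival (D r).1)).
  congr (lam _); apply/seteqP; split => u /=; first by rewrite /G /= => ->.
  by move=> /ival_inj ->.
have mG' : measurable ((fun p : I * I => (p.2, p.1)) @^-1` G).
  by apply: measurable_preimageT mG; exact: measurable_fun_pair.
have G0' : pprod lam lam ((fun p : I * I => (p.2, p.1)) @^-1` G) = 0%E.
  rewrite -G0; apply: (same_law_pair (P1 := pprod lam lam) (P2 := pprod lam lam)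
    (f1 := snd) (g1 := fst) (f2 := fst) (g2 := snd)) mG => // A B mA mB.
  rewrite (_ : _ `&` _ = B `*` A); last by apply/seteqP; split => p [].
  transitivity (pprod lam lam (A `*` B)); last by [].
  rewrite [LHS](pprodX lam lam mB mA) [RHS](pprodX lam lam mA mB); exact: muleC.
pose f a := lam [set r | (D r).1 = a].
(* If no fibre were null, [f] would be positive everywhere, although its integral is the mass 0 of
   the swapped graph. *)
have [a fa] : exists a, f a = 0%E.
  apply: contrapT => na.
  have mf : measurable_fun setT f by exact: (measurable_fun_section lam mG').
  have f01 x : (0 <= f x <= 1)%E.
    rewrite measure_ge0/= probability_le1//.
    exact: (measurable_section x mG').
  have := @integral_le_ae _ _ _ lam f (cst 0%E).
  rewrite (_ : [set x | _] = setT) ?probability_setT; last first.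
    apply/seteqP; split => // x _ /=; rewrite lt_neqAle eq_sym andbC.
    have /andP[-> _] := f01 x; apply/negP => /eqP fx; apply: na; by exists x.
  move=> H; suff : (1 : \bar R)%E = 0%E by move/eqP; rewrite onee_eq0.
  apply: H.
  - exact: integrable_bounded.
  - exact: finite_measure_integrable_cst.
  move=> B mB; rewrite integral0.
  apply: (@le_trans _ _ (\int[lam]_x f x)%E); last by rewrite /f -G0' pprodE.
  by apply: ge0_subset_integral => // x _; case/andP: (f01 x).
have DK e : D (iclamp (c (a, e))) = (a, e) by rewrite /D ival_iclamp c01 cK.
exists [set r | (D r).1 = a], (fun e => iclamp (c (a, e))), (fun r => (D r).2).
split => //.
- exact: (measurable_section a mG').
- apply: (measurableT_comp (@measurable_iclamp R)).
  exact: (measurableT_comp mc (pair1_measurable a)).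
- exact: (measurableT_comp measurable_snd mD).
- by split => [e|e] /=; rewrite DK.
Qed.

End noise_tools.

(** * The one-step bijection *)

Lemma measurable_mem d (A : measurableType d) (D : set A) :
  measurable D -> measurable_fun setT (fun a => a \in D).
Proof.
move=> mD; apply: (measurable_fun_bool true); rewrite setTI.
rewrite (_ : _ @^-1` _ = D)//; apply/seteqP; split => a /=; first by move/set_mem.
by move=> Da; exact/mem_set.
Qed.

Section cantor_bernstein.
Context d d' (A : measurableType d) (B : measurableType d').
Variables (f : A -> B) (f' : B -> A) (g : B -> A) (g' : A -> B).
Hypotheses (mf : measurable_fun setT f) (mf' : measurable_fun setT f').
Hypotheses (mg : measurable_fun setT g) (mg' : measurable_fun setT g').
Hypotheses (fK : cancel f f') (gK : cancel g g').
Hypotheses (mrf : measurable (range f)) (mrg : measurable (range g)).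

(** Points whose chain of alternating preimages stops after [n] rounds outside the range of [g]. *)
Fixpoint cb_layer (n : nat) : set A :=
  match n with
  | 0 => ~` range g
  | n'.+1 => g @` (f @` cb_layer n')
  end.

Let D := \bigcup_n cb_layer n.

(** The measurable left inverse turns an image into a preimage cut with the range. *)
Let measurable_image_f C : measurable C -> measurable (f @` C).
Proof.
move=> mC; rewrite (_ : f @` C = range f `&` f' @^-1` C).
  by apply: measurableI => //; exact: measurable_preimageT.
apply/seteqP; split => [_ [a Ca <-]|_ [[a _ <-]] /=].
  by split; [exists a|rewrite /= fK].
by rewrite fK => Ca; exists a.
Qed.

Let measurable_image_g C : measurable C -> measurable (g @` C).
Proof.
move=> mC; rewrite (_ : g @` C = range g `&` g' @^-1` C).
  by apply: measurableI => //; exact: measurable_preimageT.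
apply/seteqP; split => [_ [a Ca <-]|_ [[a _ <-]] /=].
  by split; [exists a|rewrite /= gK].
by rewrite gK => Ca; exists a.
Qed.

Let mD : measurable D.
Proof.
apply: bigcupT_measurable; elim => [|n IH] /=; first exact: measurableC.
by apply: measurable_image_g; exact: measurable_image_f.
Qed.

(** [T] is [f] on the union [D] of the layers and the inverse of [g] elsewhere. The last clause
    records this choice pointwise, so that [T] can be compared with a map that [f] extends and of
    which [g] extends the inverse. *)
Lemma measurable_cantor_bernstein : exists (T : A -> B) (S : B -> A),
  [/\ measurable_fun setT T, measurable_fun setT S, cancel T S, cancel S T &
      forall a, T a = f a \/ g (T a) = a].
Proof.
exists (fun a => if a \in D then f a else g' a).
exists (fun b => if b \in f @` D then f' b else g b).
have mfD : measurable (f @` D) by exact: measurable_image_f.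
have Dg a : ~ D a -> exists2 b, a = g b & ~ (f @` D) b.
  move=> nDa; have [b _ ba] : range g a.
    by apply: contrapT => h; apply: nDa; exists 0%N.
  exists b; first by rewrite ba.
  move=> [c [n _ Dc] cb]; apply: nDa; exists n.+1 => //=.
  by exists b => //; exists c.
have gD b : ~ (f @` D) b -> ~ D (g b).
  move=> nb [[|n] _ /=]; first by apply; exists b.
  move=> [_ [c Dc <-] /(f_equal g')]; rewrite !gK => cb.
  by apply: nb; exists c => //; exists n.
split.
- by apply: measurable_fun_ifT => //; exact: measurable_mem.
- by apply: measurable_fun_ifT => //; exact: measurable_mem.
- move=> a; have [Da|nDa] := pselect (D a).
    by rewrite (mem_set Da) mem_set ?fK//; exists a.
  by have [b -> nb] := Dg a nDa; rewrite (memNset (gD b nb)) gK (memNset nb).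
- move=> b; have [[a Da <-]|nb] := pselect ((f @` D) b).
    have fa : (f @` D) (f a) by exists a.
    by rewrite (mem_set fa) fK (mem_set Da).
  by rewrite (memNset nb) (memNset (gD b nb)) gK.
- move=> a; have [Da|nDa] := pselect (D a); first by left; rewrite mem_set.
  by right; have [b -> nb] := Dg a nDa; rewrite (memNset (gD b nb)) gK.
Qed.

End cantor_bernstein.

Section one_step.
Context (R : realType) d dH dE dE' (T : measurableType d) (H : measurableType dH)
  (E : measurableType dE) (E' : measurableType dE').
Local Notation I := (I01M R).
Local Notation lam := (lam R).
Hypotheses (bE : bitcoded R E) (bE' : bitcoded R E').
Variables (P : probability T R) (h : T -> H) (e : T -> E) (u : T -> I).
Hypotheses (mh : measurable_fun setT h) (me : measurable_fun setT e)
  (mu : measurable_fun setT u).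
Hypothesis indep : same_law P (fun w => ((h w, e w), u w))
  (pprod P lam) (fun p => ((h p.1, e p.1), p.2)).
Variables (p1 p2 : I -> I).
Hypotheses (mp1 : measurable_fun setT p1) (mp2 : measurable_fun setT p2).
Hypothesis p12 : same_law lam (fun s => (p1 s, p2 s)) (pprod lam lam) id.
Variable q : H * E * I -> E'.
Hypothesis mq : measurable_fun setT q.

Let y w := q ((h w, e w), p1 (u w)).

Let mhe : measurable_fun setT (fun w => (h w, e w)).
Proof. exact: measurable_fun_pair. Qed.

Let my : measurable_fun setT y.
Proof.
apply: (measurableT_comp mq); apply: measurable_fun_pair => //.
exact: (measurableT_comp mp1).
Qed.

Let sI : standard R I := I01_standard R.
Let bEI : bitcoded R (E * I)%type := bitcoded_prod bE (I01_bitcoded R).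
Let bEI' : bitcoded R (E' * I)%type := bitcoded_prod bE' (I01_bitcoded R).

(** [p2] is uniform and independent of [p1], so it almost surely differs from any function of
    [p1]. *)
Let graph0 (G : I -> I) : measurable_fun setT G ->
  lam [set s | p2 s = G (p1 s)] = 0%E.
Proof.
move=> mG; pose B := [set p : I * I | p.2 = G p.1].
have mB : measurable B.
  by apply: (measurable_eq_standard sI) => //; exact: (measurableT_comp mG).
apply: etrans (p12 mB) _; rewrite /= preimage_id [LHS]pprodE.
apply: integral0_eq => v _; rewrite -[RHS](lam_eq (ival (G v))); congr (lam _).
by apply/seteqP; split => v' /=; [rewrite /B /= => -> | move/ival_inj].
Qed.

Let atomless (g : H * E' -> E * I) : measurable_fun setT g ->
  P [set w | (e w, u w) = g (h w, y w)] = 0%E.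
Proof.
move=> mg.
pose G (x : H * E) (v : I) := p2 (g (x.1, q (x, v))).2.
have mG : measurable_fun setT (fun z : (H * E) * I => G z.1 z.2).
  apply: (measurableT_comp mp2); apply: (measurableT_comp measurable_snd).
  apply: (measurableT_comp mg); apply: measurable_fun_pair.
    exact: (measurableT_comp measurable_fst measurable_fst).
  by apply: (measurableT_comp mq); exact: measurable_fun_pair.
pose B := [set z : (H * E) * I | p2 z.2 = G z.1 (p1 z.2)].
have mB : measurable B.
  apply: (measurable_eq_standard sI); first exact: (measurableT_comp mp2).
  have mz : measurable_fun setT (fun z : (H * E) * I => (z.1, p1 z.2)).
    by apply: measurable_fun_pair => //; exact: (measurableT_comp mp1).
  exact: (measurableT_comp mG mz).
have B0 : pprod P lam ((fun p => ((h p.1, e p.1), p.2)) @^-1` B) = 0%E.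
  rewrite pprodE; apply: integral0_eq => w _ /=.
  have := @graph0 (G (h w, e w)); rewrite /B /=; apply.
  exact: (measurableT_comp mG (pair1_measurable (h w, e w))).
have meu : measurable_fun setT (fun w => (e w, u w)) by exact: measurable_fun_pair.
have mgy : measurable_fun setT (fun w => g (h w, y w)).
  by apply: (measurableT_comp mg); exact: measurable_fun_pair.
apply: measure0_sub (etrans (indep mB) B0).
- exact: (measurable_eq_standard (bitcoded_standard bEI)).
- by apply: measurable_preimageT mB; exact: measurable_fun_pair.
- by move=> w /= /(f_equal snd) /= uw; rewrite /B /G /= {1}uw.
Qed.

Let law_u : same_law P u lam id.
Proof.
move=> B mB; apply: etrans (same_law_comp measurable_snd indep mB) _.
transitivity (pprod P lam (setT `*` B)).
  by congr (pprod P lam _); apply/seteqP; split => p /=; [|case].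
by rewrite pprodX// probability_setT mul1e.
Qed.

Lemma one_step : exists (phi : H * (E * I) -> E' * I) (psi : H * (E' * I) -> E * I),
  [/\ measurable_fun setT phi, measurable_fun setT psi,
      (forall k x, psi (k, phi (k, x)) = x),
      (forall k z, phi (k, psi (k, z)) = z) &
      same_law P (fun w => (h w, phi (h w, (e w, u w))))
        (pprod P lam) (fun p => (h p.1, (y p.1, p.2))) /\
      exists D : set T, [/\ measurable D, P (~` D) = 0%E &
        forall w, D w -> (phi (h w, (e w, u w))).1 = y w]].
Proof.
have meu : measurable_fun setT (fun w => (e w, u w)) by exact: measurable_fun_pair.
have mhy : measurable_fun setT (fun w => (h w, y w)) by exact: measurable_fun_pair.
have sEI := bitcoded_standard bEI; have sEI' := bitcoded_standard bEI'.
have [F [Q [mF mQ FQlaw FQ]]] := uniformization mhy meu sEI atomless.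
have [K' [c' [d' [mK' K'0 mc' md' [c'K K'c]]]]] := null_code bEI.
have [K2 [c2 [d2 [mK2 K20 mc2 md2 [c2K K2c]]]]] := null_code bEI'.
pose Y (x : H * (E * I)) := q ((x.1, x.2.1), p1 x.2.2).
have mY : measurable_fun setT Y.
  apply: (measurableT_comp mq); apply: measurable_fun_pair.
    apply: measurable_fun_pair => //.
    exact: (measurableT_comp measurable_fst measurable_snd).
  apply: (measurableT_comp mp1).
  exact: (measurableT_comp measurable_snd measurable_snd).
pose f0 (x : H * (E * I)) : E' * I := (Y x, F ((x.1, Y x), x.2)).
have mf0 : measurable_fun setT f0.
  apply: measurable_fun_pair => //; apply: (measurableT_comp mF).
  by apply: measurable_fun_pair => //; exact: measurable_fun_pair.
pose g0 (z : H * (E' * I)) : E * I := Q ((z.1, z.2.1), z.2.2).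
have mg0 : measurable_fun setT g0.
  apply: (measurableT_comp mQ); apply: measurable_fun_pair; last first.
    exact: (measurableT_comp measurable_snd measurable_snd).
  apply: measurable_fun_pair => //.
  exact: (measurableT_comp measurable_fst measurable_snd).
have mf1 : measurable_fun setT (fun x : H * (E * I) => (x.1, f0 x)).
  exact: measurable_fun_pair.
have mg1 : measurable_fun setT (fun z : H * (E' * I) => (z.1, g0 z)).
  exact: measurable_fun_pair.
(* [f0] and [g0] are mutually inverse between the fibres of [A0] and [B0]. Noises in [K2] and [K']
   are excluded, because these null sets are reserved for the codes of the exceptional points. *)
pose A0 := [set x | g0 (x.1, f0 x) = x.2 /\ ~ K2 x.2.2 /\ ~ K' (f0 x).2].
pose B0 := [set z | f0 (z.1, g0 z) = z.2 /\ ~ K' z.2.2 /\ ~ K2 (g0 z).2].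
have mcoord dX (X : measurableType dX) :
  measurable_fun setT (fun x : H * (X * I) => x.2.2).
  exact: (measurableT_comp measurable_snd measurable_snd).
have mA0 : measurable A0.
  apply: measurableI.
    by apply: (measurable_eq_standard sEI) => //; exact: (measurableT_comp mg0 mf1).
  apply: measurableI; apply: (measurable_preimageT (B := ~` _)).
  - exact: mcoord.
  - exact: measurableC.
  - exact: (measurableT_comp measurable_snd mf0).
  - exact: measurableC.
have mB0 : measurable B0.
  apply: measurableI.
    by apply: (measurable_eq_standard sEI') => //; exact: (measurableT_comp mf0 mg1).
  apply: measurableI; apply: (measurable_preimageT (B := ~` _)).
  - exact: mcoord.
  - exact: measurableC.
  - exact: (measurableT_comp measurable_snd mg0).
  - exact: measurableC.
have fA0 k x : A0 (k, x) -> B0 (k, f0 (k, x)).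
  move=> [/= gf [u2 v1]]; have {}gf : g0 (k, f0 (k, x)) = x := gf.
  by rewrite /B0; split; [rewrite gf|split; [exact: v1|rewrite gf]].
have gB0 k z : B0 (k, z) -> A0 (k, g0 (k, z)).
  move=> [/= fg [v1 u2]]; have {}fg : f0 (k, g0 (k, z)) = z := fg.
  by rewrite /A0; split; [rewrite fg|split; [exact: u2|rewrite fg]].
have fgK k x : A0 (k, x) -> g0 (k, f0 (k, x)) = x by case.
have gfK k z : B0 (k, z) -> f0 (k, g0 (k, z)) = z by case.
have nB0 k y0 x : ~ B0 (k, (y0, c' x)).
  by move=> [_ [/= + _]]; apply.
have nA0 k x0 z : ~ A0 (k, (x0, c2 z)).
  by move=> [_ [/= + _]]; apply.
pose y0 : E' := point; pose x0 : E := point.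
(* Each map keeps the history as first component, so that Cantor-Bernstein works in every fibre. An
   exceptional point goes to a code with noise in [K'], hence outside [B0], and the decoder can tell
   the two cases apart; [g] does the same with [K2]. *)
pose f x := (x.1, if x \in A0 then f0 x else (y0, c' x.2)).
pose f' z := (z.1, if z \in B0 then g0 z else d' z.2.2).
pose g z := (z.1, if z \in B0 then g0 z else (x0, c2 z.2)).
pose g' x := (x.1, if x \in A0 then f0 x else d2 x.2.2).
have mf : measurable_fun setT f.
  apply: measurable_fun_pair => //; apply: measurable_fun_ifT => //.
    exact: measurable_mem.
  by apply: measurable_fun_pair => //; exact: (measurableT_comp mc').
have mf' : measurable_fun setT f'.
  apply: measurable_fun_pair => //; apply: measurable_fun_ifT => //.
    exact: measurable_mem.
  by apply: (measurableT_comp md'); exact: mcoord.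
have mg : measurable_fun setT g.
  apply: measurable_fun_pair => //; apply: measurable_fun_ifT => //.
    exact: measurable_mem.
  by apply: measurable_fun_pair => //; exact: (measurableT_comp mc2).
have mg' : measurable_fun setT g'.
  apply: measurable_fun_pair => //; apply: measurable_fun_ifT => //.
    exact: measurable_mem.
  by apply: (measurableT_comp md2); exact: mcoord.
have fK : cancel f f'.
  case=> k x; rewrite /f /f' /=; have [Ax|nAx] := pselect (A0 (k, x)).
    by rewrite (mem_set Ax) (mem_set (fA0 _ _ Ax)) fgK.
  by rewrite (memNset nAx) (memNset (nB0 k y0 x)) /= c'K.
have gK : cancel g g'.
  case=> k z; rewrite /g /g' /=; have [Bz|nBz] := pselect (B0 (k, z)).
    by rewrite (mem_set Bz) (mem_set (gB0 _ _ Bz)) gfK.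
  by rewrite (memNset nBz) (memNset (nA0 k x0 z)) /= c2K.
have mrf : measurable (range f).
  (* Since [f'] is a left inverse, the range consists of the fixed points of [f \o f']; both maps
     preserve the history, so comparing second components suffices. *)
  rewrite (_ : range f = [set z | (f (f' z)).2 = z.2]); last first.
    apply/seteqP; split => [_ [x _ <-]|z fz].
      exact: (f_equal (fun x => (f x).2) (fK x)).
    exists (f' z) => //; rewrite [LHS]surjective_pairing [RHS]surjective_pairing.
    by congr (_, _); exact: fz.
  apply: (measurable_eq_standard sEI') => //.
  exact: (measurableT_comp measurable_snd (measurableT_comp mf mf')).
have mrg : measurable (range g).
  rewrite (_ : range g = [set z | (g (g' z)).2 = z.2]); last first.
    apply/seteqP; split => [_ [x _ <-]|z fz].
      exact: (f_equal (fun x => (g x).2) (gK x)).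
    exists (g' z) => //; rewrite [LHS]surjective_pairing [RHS]surjective_pairing.
    by congr (_, _); exact: fz.
  apply: (measurable_eq_standard sEI) => //.
  exact: (measurableT_comp measurable_snd (measurableT_comp mg mg')).
have [TT [SS [mT mS TK SK Tfg]]] := measurable_cantor_bernstein mf mf' mg mg' fK gK mrf mrg.
have T1 x : (TT x).1 = x.1.
  by have [->//|/(f_equal fst)] := Tfg x.
have S1 z : (SS z).1 = z.1 by rewrite -[RHS](f_equal fst (SK z)) T1.
(* If the second alternative [g (TT x) = x] holds, then [TT x] lies in [B0], for otherwise [x] would
   be a code with noise in [K2]; [g0] is then inverted by [f0], which gives the same value. *)
have TA0 k x : A0 (k, x) -> (TT (k, x)).2 = f0 (k, x).
  move=> Ax; have [->|] := Tfg (k, x); first by rewrite /f /= mem_set.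
  have := T1 (k, x); case: (TT (k, x)) => k' z /= ->; rewrite /g /=.
  case: ifPn => [/set_mem Bz [<-]|_ [xz]]; first by rewrite gfK.
  by move: Ax; rewrite -xz => /nA0.
have TE k x : TT (k, x) = (k, (TT (k, x)).2) by rewrite [LHS]surjective_pairing T1.
have SE k z : SS (k, z) = (k, (SS (k, z)).2) by rewrite [LHS]surjective_pairing S1.
exists (fun x => (TT x).2), (fun z => (SS z).2).
pose D := (fun w => (h w, (e w, u w))) @^-1` A0.
have mheu : measurable_fun setT (fun w => (h w, (e w, u w))) by exact: measurable_fun_pair.
have mD : measurable D by exact: measurable_preimageT.
have mphi : measurable_fun setT (fun x => (TT x).2).
  exact: (measurableT_comp measurable_snd mT).
(* Three null events: recovery by [Q] fails, or one of the uniform variables [u] and [F] falls into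
   a reserved null set. *)
have D0 : P (~` D) = 0%E.
  have mFw : measurable_fun setT (fun w => F ((h w, y w), (e w, u w))).
    by apply: (measurableT_comp mF); exact: measurable_fun_pair.
  have m1 : measurable (~` [set w | Q ((h w, y w), F ((h w, y w), (e w, u w))) = (e w, u w)]).
    apply: measurableC; apply: (measurable_eq_standard sEI) => //.
    by apply: (measurableT_comp mQ); exact: measurable_fun_pair.
  have m2 : measurable (u @^-1` K2) by exact: measurable_preimageT.
  have m3 : measurable ((fun w => F ((h w, y w), (e w, u w))) @^-1` K').
    exact: measurable_preimageT.
  have n2 : P (u @^-1` K2) = 0%E by rewrite law_u.
  have n3 : P ((fun w => F ((h w, y w), (e w, u w))) @^-1` K') = 0%E.
    apply: etrans (same_law_comp measurable_snd FQlaw mK') _.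
    transitivity (pprod P lam (setT `*` K')).
      by congr (pprod P lam _); apply/seteqP; split => p /=; [|case].
    by rewrite pprodX// K'0 mule0.
  apply/(measure_negligible (measurableC mD)).
  have neg C : measurable C -> P C = 0%E -> P.-negligible C.
    by move=> mC C0; apply/negligibleP.
  have N := negligibleU (neg _ m1 FQ) (negligibleU (neg _ m2 n2) (neg _ m3 n3)).
  apply: negligibleS N => w nD; apply: contrapT => /not_orP[/contrapT a1 /not_orP[a2 a3]].
  by apply: nD.
split.
- exact: mphi.
- exact: (measurableT_comp measurable_snd mS).
- by move=> k x; rewrite -TE TK.
- by move=> k z; rewrite -SE SK.
split; last first.
  by exists D; split => // w Dw; rewrite TA0.
have step1 : same_law P (fun w => (h w, (TT (h w, (e w, u w))).2))
    P (fun w => (h w, f0 (h w, (e w, u w)))).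
  apply: (same_law_ae _ _ mD D0).
  - by apply: measurable_fun_pair => //; exact: (measurableT_comp mphi).
  - by apply: measurable_fun_pair => //; exact: (measurableT_comp mf0).
  - by move=> w /set_mem Dw; rewrite TA0.
apply: same_law_trans step1 _.
have mre : measurable_fun setT (fun z : (H * E') * I => (z.1.1, (z.1.2, z.2))).
  apply: measurable_fun_pair; first exact: (measurableT_comp measurable_fst measurable_fst).
  apply: measurable_fun_pair => //.
  exact: (measurableT_comp measurable_snd measurable_fst).
exact: (same_law_comp mre FQlaw).
Qed.

End one_step.

(** * Independent noises *)

Section product_laws.
Context (R : realType).

Lemma same_law_triple d1 d2 e1 e2 e3 (T1 : measurableType d1) (T2 : measurableType d2)
  (E1 : measurableType e1) (E2 : measurableType e2) (E3 : measurableType e3)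
  (P1 : probability T1 R) (P2 : probability T2 R)
  (f1 : T1 -> E1) (g1 : T1 -> E2) (k1 : T1 -> E3)
  (f2 : T2 -> E1) (g2 : T2 -> E2) (k2 : T2 -> E3) :
  measurable_fun setT f1 -> measurable_fun setT g1 -> measurable_fun setT k1 ->
  measurable_fun setT f2 -> measurable_fun setT g2 -> measurable_fun setT k2 ->
  (forall A B C, measurable A -> measurable B -> measurable C ->
    P1 (k1 @^-1` C `&` (f1 @^-1` A `&` g1 @^-1` B)) =
    P2 (k2 @^-1` C `&` (f2 @^-1` A `&` g2 @^-1` B))) ->
  same_law P1 (fun x => ((f1 x, g1 x), k1 x)) P2 (fun x => ((f2 x, g2 x), k2 x)).
Proof.
move=> mf1 mg1 mk1 mf2 mg2 mk2 H.
have m1 := measurable_fun_pair mf1 mg1; have m2 := measurable_fun_pair mf2 mg2.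
apply: same_law_pair => // A B mA mB.
have mB1 := measurable_preimageT mk1 mB; have mB2 := measurable_preimageT mk2 mB.
rewrite setIC [in RHS]setIC.
change (rlaw P1 mB1 m1 A = rlaw P2 mB2 m2 A).
by apply: finite_measure_eq_prod => // C D mC mD; exact: H.
Qed.

Context d1 d2 d3 (T1 : measurableType d1) (T2 : measurableType d2)
  (T3 : measurableType d3).
Variables (P : probability T1 R) (Q : probability T2 R) (Q' : probability T3 R).

Lemma pprod3E A B C : measurable A -> measurable B -> measurable C ->
  pprod (pprod P Q) Q' ((A `*` B) `*` C) = (P A * Q B * Q' C)%E.
Proof.
move=> mA mB mC; rewrite pprodX//; last exact: measurableX.
by congr (_ * _)%E; exact: pprodX.
Qed.

Lemma pprod_swap : same_law (pprod (pprod P Q) Q') (fun p => ((p.1.1, p.2), p.1.2))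
  (pprod (pprod P Q') Q) id.
Proof.
have -> : id = (fun p : T1 * T3 * T2 => ((p.1.1, p.1.2), p.2)).
  by apply/funext => -[[? ?] ?].
apply: same_law_triple => //.
- exact: (measurableT_comp measurable_fst measurable_fst).
- exact: (measurableT_comp measurable_snd measurable_fst).
- exact: (measurableT_comp measurable_fst measurable_fst).
- exact: (measurableT_comp measurable_snd measurable_fst).
move=> A B C mA mB mC.
transitivity (pprod (pprod P Q) Q' ((A `*` C) `*` B)).
  by congr (_ _); apply/seteqP; split => -[[a b] c] /= [] => [? [? ?]|[? ?] ?].
transitivity (pprod (pprod P Q') Q ((A `*` B) `*` C)); last first.
  by congr (_ _); apply/seteqP; split => -[[a b] c] /= [] => [[? ?] ?|? [? ?]].
rewrite pprod3E// pprodX//; last exact: measurableX.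
rewrite [X in _ = (X * _)%E](pprodX P Q' mA mB).
by rewrite -!muleA; congr (_ * _)%E; exact: muleC.
Qed.

Lemma pprod_assoc : same_law (pprod (pprod P Q) Q') (fun p => (p.1.1, (p.1.2, p.2)))
  (pprod P (pprod Q Q')) id.
Proof.
have h : same_law (pprod (pprod P Q) Q') (fun p => ((p.1.1, p.1.2), p.2))
    (pprod P (pprod Q Q')) (fun p => ((p.1, p.2.1), p.2.2)).
  apply: same_law_triple => //.
  - exact: (measurableT_comp measurable_fst measurable_fst).
  - exact: (measurableT_comp measurable_snd measurable_fst).
  - exact: (measurableT_comp measurable_fst measurable_snd).
  - exact: (measurableT_comp measurable_snd measurable_snd).
  move=> A B C mA mB mC.
  transitivity (pprod (pprod P Q) Q' ((A `*` B) `*` C)).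
    by congr (_ _); apply/seteqP; split => -[[a b] c] /= [] => [? [? ?]|[? ?] ?].
  transitivity (pprod P (pprod Q Q') (A `*` (B `*` C))); last first.
    by congr (_ _); apply/seteqP; split => -[a [b c]] /= [] => [? [? ?]|? [? ?]].
  rewrite pprod3E// pprodX//; last exact: measurableX.
  by rewrite [X in _ = (_ * X)%E](pprodX Q Q' mB mC) muleA.
have m : measurable_fun setT (fun z : T1 * T2 * T3 => (z.1.1, (z.1.2, z.2))).
  apply: measurable_fun_pair; first exact: (measurableT_comp measurable_fst measurable_fst).
  apply: measurable_fun_pair => //.
  exact: (measurableT_comp measurable_snd measurable_fst).
move=> B mB; apply: etrans (same_law_comp m h mB) _.
by congr (_ _); apply/seteqP; split => -[a [b c]].
Qed.

End product_laws.

Lemma same_law_noise_r (R : realType) d1 d2 d3 d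
  (T1 : measurableType d1) (T2 : measurableType d2) (T3 : measurableType d3)
  (E : measurableType d) (Q : probability T3 R)
  (P1 : probability T1 R) (P2 : probability T2 R) (f1 : T1 -> E) (f2 : T2 -> E) :
  measurable_fun setT f1 -> measurable_fun setT f2 ->
  same_law P1 f1 P2 f2 ->
  same_law (pprod Q P1) (fun p => (p.1, f1 p.2)) (pprod Q P2) (fun p => (p.1, f2 p.2)).
Proof.
move=> m1 m2 H; apply: same_law_pair => //.
- exact: (measurableT_comp m1).
- exact: (measurableT_comp m2).
move=> A B mA mB.
transitivity (pprod Q P1 (A `*` (f1 @^-1` B))); first by [].
transitivity (pprod Q P2 (A `*` (f2 @^-1` B))); last by [].
by rewrite !pprodX ?H//; exact: measurable_preimageT.
Qed.

Lemma same_law_fst (R : realType) d1 d2 (T1 : measurableType d1) (T2 : measurableType d2)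
  (P : probability T1 R) (Q : probability T2 R) : same_law (pprod P Q) fst P id.
Proof.
move=> B mB; transitivity (pprod P Q (B `*` setT)).
  by congr (_ _); apply/seteqP; split => p /= => [|[]].
by rewrite pprodX// probability_setT mule1.
Qed.

Section iterated_noise.
Variables (R : realType) (N : nat).
Local Notation I := (I01M R).
Local Notation lam := (lam R).

Definition U_gen : set (set ('I_N -> I01 R)) :=
  [set A | exists t : 'I_N, exists D : set (I01 R),
     I01_gen D /\ A = (fun u : 'I_N -> I01 R => u t) @^-1` D].

Definition UM := g_sigma_algebraType U_gen.

Lemma measurable_coordU (t : 'I_N) : measurable_fun setT (fun u : UM => u t : I).
Proof.
by apply: measurable_fun_gen => D HD; apply: sub_sigma_algebra; exists t, D.
Qed.

Lemma measurable_fun_UM d (A : measurableType d) (f : A -> UM) :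
  (forall t, measurable_fun setT (fun a => f a t : I)) -> measurable_fun setT f.
Proof.
move=> H; apply: measurable_fun_gen => _ [t [D [HD ->]]].
by apply: (measurable_preimageT (H t)); exact: sub_sigma_algebra.
Qed.

Definition updI (u : UM) (k : nat) (v : I) : UM := fun i => if i == k :> nat then v else u i.

Lemma measurable_updI k : measurable_fun setT (fun p : UM * I => updI p.1 k p.2).
Proof.
apply: measurable_fun_UM => t; rewrite /updI; case: eqP => _; first exact: measurable_snd.
exact: (measurableT_comp (measurable_coordU t) measurable_fst).
Qed.

Lemma updI_swap u j k v w : j != k -> updI (updI u j v) k w = updI (updI u k w) j v.
Proof.
move=> jk; apply/funext => i; rewrite /updI; case: eqP => [ik|//]; case: eqP => // ij.
by move: jk; rewrite -ik -ij eqxx.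
Qed.

Lemma updI_same u k v w : updI (updI u k v) k w = updI u k w.
Proof. by apply/funext => i; rewrite /updI; case: eqP. Qed.

Definition zeroU : UM := fun=> I01_pt R.

(** Coordinates below [k] are independent and uniform, the others stay at the base point; the
    recursion follows that of [iint]. *)
Fixpoint LNk (k : nat) : probability UM R :=
  match k with
  | 0 => dirac zeroU
  | k'.+1 => law (pprod (LNk k') lam) (measurable_updI k')
  end.

Definition LN := LNk N.

(** [iint k] only changes coordinates below [k]. This reconciles [iint], which sets coordinate [k]
    before the inner ones, with [LNk], which sets it after them. *)
Lemma iint_upd (k k' : nat) (f : ('I_N -> I01 R) -> \bar R) u s : (k <= k')%N ->
  iint k f (upd R N u k' s) = iint k (fun w => f (upd R N w k' s)) u.
Proof.
elim: k u => [//|k IH] u kk' /=; apply: eq_integral => s' _.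
rewrite -IH ?(ltnW kk')//; congr (iint k f _).
by apply: updI_swap; rewrite neq_ltn kk' orbT.
Qed.

Lemma iintE k (f : UM -> \bar R) : measurable_fun setT f -> (forall u, 0 <= f u)%E ->
  iint k f (fun=> I01_pt R) = (\int[LNk k]_u f u)%E.
Proof.
elim: k f => [|k IH] f mf f0 /=.
  by rewrite integral_dirac// diracT mul1e.
have mfu v : measurable_fun setT (fun w => f (updI w k v)).
  exact: (measurableT_comp mf (measurableT_comp (measurable_updI k) (pair2_measurable v))).
have mfp : measurable_fun setT (fun p : UM * I => f (updI p.1 k p.2)).
  exact: (measurableT_comp mf (measurable_updI k)).
rewrite (ge0_integral_law _ (measurable_updI k))//.
rewrite (@fubini_tonelli2 _ _ _ _ _ (LNk k) lam (fun p => f (updI p.1 k p.2)) mfp)//.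
rewrite ge0_integral_lam; last 2 first.
- by apply: measurable_fun_fubini_tonelli_G.
- by move=> v; apply: integral_ge0.
apply: eq_integral => s _; rewrite iint_upd// IH//.
exact: (mfu (clamp01 R s)).
Qed.

Lemma lebNE (S : set UM) : measurable S -> lebN S = LN S.
Proof.
move=> mS; rewrite /lebN iintE//.
  by rewrite integral_indic// setIT.
by apply/measurable_EFinP; exact: measurable_indic.
Qed.

(** If [t] is the coordinate drawn last, the new draw overwrites it; otherwise the two updates
    commute and the induction hypothesis applies. Independence of the noise at time [t] from the
    rest is always used in this form. *)
Lemma LNk_resample (k t : nat) : (t < k)%N ->
  same_law (pprod (LNk k) lam) (fun p => updI p.1 t p.2) (LNk k) id.
Proof.
elim: k t => [//|k IH] t; rewrite ltnS => tk.
have mt := measurable_updI t; have mk := measurable_updI k.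
have h : same_law (pprod (LNk k.+1) lam) (fun p => (p.1, p.2))
    (pprod (pprod (LNk k) lam) lam) (fun p => (updI p.1.1 k p.1.2, p.2)).
  exact: (same_law_noise lam (f1 := id) (f2 := fun p => updI p.1 k p.2)).
apply: same_law_trans (same_law_comp mt h) _.
suff : same_law (pprod (pprod (LNk k) lam) lam)
    (fun p => updI (updI p.1.1 k p.1.2) t p.2)
    (pprod (LNk k) lam) (fun p => updI p.1 k p.2) by [].
move: tk; rewrite leq_eqVlt => /predU1P[tk|tk].
  subst t.
  have h2 := same_law_noise lam (@measurable_fst _ _ UM I)
    (@measurable_id _ UM setT) (same_law_fst (LNk k) lam).
  move=> B mB; apply: etrans (same_law_comp mk h2 mB).
  by congr (_ _); apply/seteqP; split => p /=; rewrite updI_same.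
have h3 := same_law_noise lam mt (@measurable_id _ UM setT) (IH _ tk).
have mmt : measurable_fun setT (fun p : UM * I * I => (updI p.1.1 t p.1.2, p.2)).
  by apply: measurable_fun_pair => //; exact: (measurableT_comp mt measurable_fst).
have h4 := same_law_trans (same_law_comp mmt (pprod_swap (LNk k) lam lam)) h3.
move=> B mB; apply: etrans (same_law_comp mk h4 mB).
by congr (_ _); apply/seteqP; split => p /=; rewrite updI_swap// neq_ltn tk ?orbT.
Qed.

End iterated_noise.

(** * Path spaces *)

Section path_space.
Variables (R : realType) (N : nat) (X : 'I_N -> completePseudoMetricType R).
Local Notation I := (I01M R).
Local Notation U := (UM R N).

Definition BM (t : 'I_N) := g_sigma_algebraType (@open (X t)).

Definition hatS := (PiM X * U)%type.

Lemma measurable_coordX t : measurable_fun setT (fun x : PiM X => x t : BM t).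
Proof.
apply: measurable_fun_gen => V oV; apply: sub_sigma_algebra; exists t, V; split => //.
exact: sub_sigma_algebra.
Qed.

Lemma measurable_fun_PiM d (A : measurableType d) (f : A -> PiM X) :
  (forall t, measurable_fun setT (fun a => f a t : BM t)) -> measurable_fun setT f.
Proof.
move=> H; apply: measurable_fun_gen => _ [t [B [mB ->]]].
exact: (measurable_preimageT (H t)).
Qed.

Definition setX (x : PiM X) (t : 'I_N) (e : BM t) : PiM X := dfwith x t e.

Lemma measurable_setX t : measurable_fun setT (fun p : PiM X * BM t => setX p.1 p.2).
Proof.
apply: measurable_fun_PiM => s; have [ts|ts] := eqVneq t s.
  subst s; rewrite (_ : (fun _ => _) = snd); first exact: measurable_snd.
  by apply/funext => p; rewrite /setX dfwithin.
rewrite (_ : (fun _ => _) = (fun p : PiM X * BM t => p.1 s)).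
  exact: (measurableT_comp (@measurable_coordX s) (@measurable_fst _ _ (PiM X) (BM t))).
by apply/funext => p; rewrite /setX dfwithout.
Qed.

(** Resetting instead of passing to a shorter product keeps the type of a history independent of
    [t]. *)
Definition trX (t : nat) (x : PiM X) : PiM X :=
  fun s => if (s < t)%N then x s else point.

Definition trU (t : nat) (u : U) : U := fun s => if (s < t)%N then u s else I01_pt R.

Definition trH (t : nat) (a : hatS) : hatS := (trX t a.1, trU t a.2).

Definition setH (a : hatS) (t : 'I_N) (z : BM t * I) : hatS :=
  (setX a.1 z.1, updI a.2 t z.2).

Definition coordH (t : 'I_N) (a : hatS) : BM t * I := (a.1 t, a.2 t).

Lemma measurable_trX t : measurable_fun setT (trX t).
Proof.
apply: measurable_fun_PiM => s; rewrite /trX; case: ltnP => _.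
  exact: measurable_coordX.
exact: measurable_cst.
Qed.

Lemma measurable_trU t : measurable_fun setT (trU t).
Proof.
apply: measurable_fun_UM => s; rewrite /trU; case: ltnP => _.
  exact: measurable_coordU.
exact: measurable_cst.
Qed.

Lemma measurable_trH t : measurable_fun setT (trH t).
Proof.
apply: measurable_fun_pair.
  exact: (measurableT_comp (measurable_trX t) measurable_fst).
exact: (measurableT_comp (measurable_trU t) measurable_snd).
Qed.

Lemma measurable_coordH t : measurable_fun setT (coordH t).
Proof.
apply: measurable_fun_pair.
  exact: (measurableT_comp (@measurable_coordX t) measurable_fst).
exact: (measurableT_comp (@measurable_coordU R N t) measurable_snd).
Qed.

Lemma measurable_setH t : measurable_fun setT (fun p : hatS * (BM t * I) => setH p.1 p.2).
Proof.
have mX : measurable_fun setT (fun p : hatS * (BM t * I) => (p.1.1, p.2.1)).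
  apply: measurable_fun_pair; first exact: (measurableT_comp measurable_fst measurable_fst).
  exact: (measurableT_comp measurable_fst measurable_snd).
have mU : measurable_fun setT (fun p : hatS * (BM t * I) => (p.1.2, p.2.2)).
  apply: measurable_fun_pair; first exact: (measurableT_comp measurable_snd measurable_fst).
  exact: (measurableT_comp measurable_snd measurable_snd).
apply: measurable_fun_pair.
  exact: (measurableT_comp (@measurable_setX t) mX).
exact: (measurableT_comp (@measurable_updI R N t) mU).
Qed.

Lemma trX_tr s t x : (s <= t)%N -> trX s (trX t x) = trX s x.
Proof.
move=> st; apply/functional_extensionality_dep => i; rewrite /trX.
by case: ltnP => // /leq_trans -> //.
Qed.

Lemma trU_tr s t u : (s <= t)%N -> trU s (trU t u) = trU s u.
Proof.
by move=> st; apply/funext => i; rewrite /trU; case: ltnP => // /leq_trans -> //.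
Qed.

Lemma trH_tr s t a : (s <= t)%N -> trH s (trH t a) = trH s a.
Proof. by move=> st; rewrite /trH /= trX_tr// trU_tr. Qed.

Lemma trX_set (t : 'I_N) x (e : BM t) : trX t (setX x e) = trX t x.
Proof.
apply/functional_extensionality_dep => i; rewrite /trX; case: ltnP => // it.
by rewrite /setX dfwithout//; apply: contraTneq it => ->; rewrite ltnn.
Qed.

Lemma trU_upd (t : nat) u v : trU t (updI u t v) = trU t u.
Proof.
apply/funext => i; rewrite /trU /updI; case: ltnP => // it.
by rewrite (ltn_eqF it).
Qed.

Lemma trH_set (t : 'I_N) a (z : BM t * I) : trH t (setH a z) = trH t a.
Proof. by rewrite /trH /= trX_set trU_upd. Qed.

Lemma setX_tr (t : 'I_N) x (e : BM t) : setX (trX t x) e = trX t.+1 (setX x e).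
Proof.
apply/functional_extensionality_dep => i; rewrite /trX /setX ltnS.
have [ti|ti] := eqVneq t i; first by subst i; rewrite leqnn !dfwithin.
rewrite dfwithout// dfwithout// [(i <= t)%N]leq_eqVlt.
by have -> : (i == t :> nat) = false by rewrite val_eqE eq_sym (negbTE ti).
Qed.

Lemma updI_tr (t : 'I_N) u v : updI (trU t u) t v = trU t.+1 (updI u t v).
Proof.
apply/funext => i; rewrite /trU /updI ltnS.
case: (eqVneq (i : nat) t) => [->|it]; first by rewrite leqnn.
by rewrite [(i <= t)%N]leq_eqVlt (negbTE it).
Qed.

Lemma setX_id (t : 'I_N) x : setX x (x t : BM t) = x.
Proof.
apply/functional_extensionality_dep => i; rewrite /setX.
by have [ti|ti] := eqVneq t i; [subst i; rewrite dfwithin|rewrite dfwithout].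
Qed.

Lemma updI_id (t : 'I_N) (u : U) : updI u t (u t) = u.
Proof. by apply/funext => i; rewrite /updI; case: eqP => // /val_inj ->. Qed.

Lemma setH_tr (t : 'I_N) a : setH (trH t a) (coordH t a) = trH t.+1 a.
Proof. by rewrite /setH /trH /coordH /= setX_tr updI_tr setX_id updI_id. Qed.

Lemma coordH_set (t : 'I_N) a (z : BM t * I) : coordH t (setH a z) = z.
Proof.
by case: z => e v; rewrite /coordH /setH /= /setX dfwithin /updI eqxx.
Qed.

Lemma coordH_tr (t : 'I_N) a : coordH t (trH t.+1 a) = coordH t a.
Proof. by rewrite /coordH /trH /trX /trU /= ltnSn. Qed.

Lemma trH_N a : trH N a = a.
Proof.
case: a => x u; congr (_, _).
  by apply/functional_extensionality_dep => i; rewrite /trX ltn_ord.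
by apply/funext => i; rewrite /trU ltn_ord.
Qed.

Lemma trX_N x : trX N x = x.
Proof. by apply/functional_extensionality_dep => i; rewrite /trX ltn_ord. Qed.

Lemma trX0 x y : trX 0 x = trX 0 y.
Proof. exact/functional_extensionality_dep. Qed.

Lemma trU0 (u v : U) : trU 0 u = trU 0 v.
Proof. exact/funext. Qed.

Lemma cyl_upto_trX t (B : set (PiM X)) : measurable B ->
  <<s cyl_upto X t >> (trX t @^-1` B).
Proof.
move=> mB.
pose F := g_sigma_algebraType (cyl_upto X t).
suff m : measurable_fun setT (trX t : F -> PiM X).
  exact: (measurable_preimageT m mB).
apply: measurable_fun_PiM => s; rewrite /trX; case: ltnP => st; last exact: measurable_cst.
apply: measurable_fun_gen => V oV; apply: sub_sigma_algebra; exists s; split => //.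
by exists V; split => //; exact: sub_sigma_algebra.
Qed.

(** Together with [cyl_upto_trX] this identifies the sigma-algebra of the first [t] coordinates with
    the measurable sets invariant under truncation. *)
Lemma cyl_uptoP t (A : set (PiM X)) : <<s cyl_upto X t >> A ->
  measurable A /\ trX t @^-1` A = A.
Proof.
move=> HA; split.
  have m : measurable_fun setT (id : PiM X -> g_sigma_algebraType (cyl_upto X t)).
    apply: measurable_fun_gen => _ [s [_ [B [mB ->]]]].
    by apply: sub_sigma_algebra; exists s, B.
  exact: (measurable_preimageT m HA).
(* The invariant sets form a sigma-algebra containing the generating cylinders, and [HA] expresses
   membership in the smallest such sigma-algebra. *)
apply: (HA [set A | trX t @^-1` A = A]); split; first split.
- by rewrite /= preimage_set0.
- by move=> B /= BE; rewrite setTD -preimage_setC BE.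
- move=> F FE /=; rewrite preimage_bigcup; apply: eq_bigcupr => n _; exact: FE.
- by move=> _ [s [st [B [_ ->]]]]; apply/seteqP; split => x /=; rewrite /trX st.
Qed.

Lemma hat_measurable (A : set (HatM X)) :
  measurable A <-> measurable (A : set hatS).
Proof.
have m1 : measurable_fun setT (fun a : HatM X => (a.1, a.2) : hatS).
  apply: measurable_fun_pair.
    apply: measurable_fun_PiM => t; apply: measurable_fun_gen => V oV.
    apply: sub_sigma_algebra; exists t; left; exists V; split => //.
    exact: sub_sigma_algebra.
  apply: measurable_fun_UM => t; apply: measurable_fun_gen => _ [D [mD ->]].
  by apply: sub_sigma_algebra; exists t; right; exists D.
have m2 : measurable_fun setT (fun a : hatS => (a.1, a.2) : HatM X).
  apply: measurable_fun_gen => _ [t [[B [mB ->]]|[D [mD ->]]]].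
    have m := measurableT_comp (@measurable_coordX t) (@measurable_fst _ _ (PiM X) U).
    exact: (measurable_preimageT m mB).
  have m := measurableT_comp (@measurable_coordU R N t) (@measurable_snd _ _ (PiM X) U).
  have m' := measurableT_comp (@measurable_ival R) m.
  exact: (measurable_preimageT m' mD).
have e B : (fun a : hat X => (a.1, a.2)) @^-1` B = B.
  by apply/seteqP; split => -[].
by split => mA; [have := measurable_preimageT m2 mA|have := measurable_preimageT m1 mA];
  rewrite e.
Qed.

Variable mu : probability (PiM X) R.

Definition hatP : probability hatS R := pprod mu (LN R N).

Lemma hatmeasureE (A : set hatS) : measurable A -> hatmeasure X mu A = hatP A.
Proof.
move=> mA; rewrite /hatP /= pprodE; apply: eq_integral => x _.
by rewrite lebNE//; exact: measurable_section.
Qed.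

Lemma hatP_resample (t : 'I_N) :
  same_law (pprod hatP (lam R)) (fun p => (p.1.1, updI p.1.2 t p.2)) hatP id.
Proof.
have h := same_law_noise_r mu (@measurable_updI R N t) (@measurable_id _ U setT)
  (@LNk_resample R N N t (ltn_ord t)).
have m : measurable_fun setT (fun p : PiM X * (U * I) => (p.1, updI p.2.1 t p.2.2)).
  apply: measurable_fun_pair => //.
  exact: (measurableT_comp (@measurable_updI R N t) measurable_snd).
have h' := same_law_trans (same_law_comp m (pprod_assoc mu (LN R N) (lam R))) h.
move=> B mB; apply: etrans (h' B mB) _.
by congr (_ _); apply/seteqP; split => -[].
Qed.

End path_space.

(** * Causality *)

Section causality.
Variables (R : realType) (N : nat) (X Y : 'I_N -> completePseudoMetricType R).
Variable mu : probability (PiM X) R.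
Local Notation I := (I01M R).
Local Notation lam := (lam R).

(** Measurability with respect to the past becomes a pointwise identity, valid for every [x]. *)
Lemma causal_kernel_tr (k : R.-pker (PiM X) ~> (PiM Y)) :
  (forall t : nat, (0 < t < N)%N ->
     forall B : set (PiM Y), <<s cyl_upto Y t >> B ->
     forall U : set (\bar R), measurable U ->
       <<s cyl_upto X t >> ((fun x => k x B) @^-1` U)) ->
  forall t, (t < N)%N -> forall B : set (PiM Y), measurable B -> forall x,
    k (trX t x) (trX t @^-1` B) = k x (trX t @^-1` B).
Proof.
move=> kF [|t] tN B mB x.
  (* Causality speaks of [0 < t] only; at time 0 the preimage is empty or the whole space. *)
  have [h|h] := pselect (B (trX 0 point)).
    rewrite (_ : _ @^-1` _ = setT) ?prob_kernel//.
    by apply/seteqP; split => // y _ /=; rewrite (trX0 y point).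
  rewrite (_ : _ @^-1` _ = set0) ?measure0//.
  by rewrite -subset0 => y /=; rewrite (trX0 y point).
(* The level set of the value at the truncated path is invariant under truncation; it contains the
   truncated path, hence [x] itself. *)
pose c := k (trX t.+1 x) (trX t.+1 @^-1` B).
have tN' : (0 < t.+1 < N)%N by [].
have FA := kF _ tN' _ (@cyl_upto_trX R N Y t.+1 B mB) [set c] (emeasurable_set1 c).
have [_ e] := cyl_uptoP FA.
have : (trX t.+1 @^-1` ((fun x => k x (trX t.+1 @^-1` B)) @^-1` [set c])) x by [].
by rewrite e => /esym.
Qed.

(** Given the whole path [x], both conditional laws depend on [trX t x] only: that of [(T a).1]
    because [T] reads the history alone, that of the [Y]-history by causality. [integral_transfer]
    then extends the equality from [trX t x] to [x]. *)
Lemma causal_law (pi : probability (PiM X * PiM Y)%type R) (t : nat)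
  (T : hatS X -> hatS Y) : causal X Y mu pi -> (t < N)%N ->
  measurable_fun setT T -> (forall a, T (trH t a) = T a) ->
  same_law (hatP mu) (fun a => (trX t a.1, (T a).1))
    pi (fun p => (trX t p.1, trX t p.2)) ->
  same_law (hatP mu) (fun a => (a.1, (T a).1)) pi (fun p => (p.1, trX t p.2)).
Proof.
move=> [k [kE kF]] tN mT Ttr I2.
have ktr := causal_kernel_tr kF tN.
have mT1 : measurable_fun setT (fun a => (T a).1).
  exact: (measurableT_comp measurable_fst mT).
have mtrX : measurable_fun setT (@trX R N X t) := @measurable_trX R N X t.
have mtrY : measurable_fun setT (@trX R N Y t) := @measurable_trX R N Y t.
apply: same_law_pair => //; first exact: (measurableT_comp mtrY).
move=> A B mA mB.
pose f1 x := LN R N [set u | ((fun a => (T a).1) @^-1` B) (x, u)].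
pose f2 x := k x (trX t @^-1` B).
have mtB := measurable_preimageT mtrY mB.
have mTB := measurable_preimageT mT1 mB.
have f1tr x : f1 (trX t x) = f1 x.
  have e u : T (trX t x, u) = T (x, u) by rewrite -Ttr -[RHS]Ttr /trH /= trX_tr.
  by congr (LN R N _); apply/seteqP; split => u /=; rewrite e.
have mf1 : measurable_fun setT f1 by exact: (measurable_fun_section (LN R N) mTB).
have mf2 : measurable_fun setT f2 by exact: measurable_kernel.
have f101 x : (0 <= f1 x <= 1)%E.
  by rewrite measure_ge0/= probability_le1//; exact: (measurable_section x mTB).
have f201 x : (0 <= f2 x <= 1)%E.
  rewrite measure_ge0/= -(prob_kernel (s := k) x).
  by apply: le_measure; rewrite ?inE.
have L C : measurable C -> hatP mu (fst @^-1` C `&` (fun a => (T a).1) @^-1` B) =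
    (\int[mu]_(x in C) f1 (trX t x))%E.
  move=> mC; rewrite setIC [LHS]pprodE_fst//.
  by apply: eq_integral => x _; rewrite f1tr.
have M C : measurable C -> pi (fst @^-1` C `&` (fun p => trX t p.2) @^-1` B) =
    (\int[mu]_(x in C) f2 (trX t x))%E.
  move=> mC; transitivity (pi (C `*` trX t @^-1` B)); first by [].
  by rewrite kE//; apply: eq_integral => x _; rewrite /f2 ktr.
rewrite [LHS](L _ mA) [RHS](M _ mA).
apply: (integral_transfer mtrX mf1 mf2 f101 f201) => // C mC.
have mC' := measurable_preimageT mtrX mC.
rewrite -[LHS](L _ mC') -[RHS](M _ mC').
exact: (I2 (C `*` B) (measurableX mC mB)).
Qed.

(** The noises are independent of the path, so adding the past noises to the conditioning does not
    change the conditional law of the new coordinate. *)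
Lemma hatP_randomization (t : 'I_N) (xi : PiM X * I -> BM X t) :
  measurable_fun setT xi ->
  same_law (pprod mu lam) (fun p => (trX t p.1, xi (trX t p.1, p.2)))
    mu (fun x => (trX t x, x t : BM X t)) ->
  same_law (hatP mu) (fun a => (trH t a, a.1 t : BM X t))
    (pprod (hatP mu) lam) (fun p => (trH t p.1, xi (trX t p.1.1, p.2))).
Proof.
move=> mxi h.
have mtr : measurable_fun setT (@trX R N X t) := @measurable_trX R N X t.
have mc : measurable_fun setT (fun p : PiM X * I => (trX t p.1, xi (trX t p.1, p.2))).
  have m1 : measurable_fun setT (fun p : PiM X * I => trX t p.1).
    exact: (measurableT_comp mtr measurable_fst).
  apply: measurable_fun_pair => //; apply: (measurableT_comp mxi).
  exact: measurable_fun_pair.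
have mc' : measurable_fun setT (fun x : PiM X => (trX t x, x t : BM X t)).
  by apply: measurable_fun_pair => //; exact: measurable_coordX.
have n := same_law_noise (LN R N) mc mc' h.
have mre : measurable_fun setT (fun z : (PiM X * BM X t) * UM R N =>
    ((z.1.1, trU t z.2), z.1.2)).
  apply: measurable_fun_pair; last exact: (measurableT_comp measurable_snd measurable_fst).
  apply: measurable_fun_pair; first exact: (measurableT_comp measurable_fst measurable_fst).
  exact: (measurableT_comp (@measurable_trU R N t) measurable_snd).
have msw : measurable_fun setT (fun z : (PiM X * UM R N) * I =>
    ((trX t z.1.1, trU t z.1.2), xi (trX t z.1.1, z.2))).
  have m1 : measurable_fun setT (fun z : (PiM X * UM R N) * I => trX t z.1.1).
    apply: (measurableT_comp mtr).
    exact: (measurableT_comp measurable_fst measurable_fst).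
  apply: measurable_fun_pair.
    apply: measurable_fun_pair => //; apply: (measurableT_comp (@measurable_trU R N t)).
    exact: (measurableT_comp measurable_snd measurable_fst).
  by apply: (measurableT_comp mxi); exact: measurable_fun_pair.
apply: same_law_trans (same_law_sym (same_law_comp mre n)) _.
exact: (same_law_comp msw (pprod_swap mu lam (LN R N))).
Qed.

(** Resampling the noise at time [t] preserves the law and does not affect [f]. *)
Lemma hatP_indep (t : 'I_N) d (E : measurableType d) (f : hatS X -> E) :
  measurable_fun setT f ->
  (forall x u v, f (x, updI u t v) = f (x, u)) ->
  same_law (hatP mu) (fun a => (f a, a.2 t : I)) (pprod (hatP mu) lam) (fun p => (f p.1, p.2)).
Proof.
move=> mf fE.
have m : measurable_fun setT (fun a => (f a, a.2 t : I)).
  apply: measurable_fun_pair => //.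
  exact: (measurableT_comp (@measurable_coordU R N t) (@measurable_snd _ _ (PiM X) (UM R N))).
apply: same_law_sym; move=> B mB; rewrite -[RHS](same_law_comp m (hatP_resample mu t) mB).
by congr (_ _); apply/seteqP; split => -[[x u] v] /=; rewrite fE /updI eqxx.
Qed.

End causality.

(** * Induction on time *)

Ltac mfun := repeat first
  [ assumption
  | exact: measurable_id
  | exact: measurable_fst
  | exact: measurable_snd
  | match goal with
    | H : @measurable_fun _ _ _ _ _ ?f |- @measurable_fun _ _ _ _ _ (fun x => ?f (@?g x)) =>
        apply: (measurableT_comp H)
    | |- @measurable_fun _ _ _ _ _ (fun x => fst (@?g x)) =>
        apply: (measurableT_comp measurable_fst)
    | |- @measurable_fun _ _ _ _ _ (fun x => snd (@?g x)) =>
        apply: (measurableT_comp measurable_snd)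
    end
  | apply: measurable_fun_pair ].

Lemma same_law_eqfun (R : realType) d1 d2 d (T1 : measurableType d1)
  (T2 : measurableType d2) (E : measurableType d) (P1 : set T1 -> \bar R)
  (P2 : set T2 -> \bar R) (f1 f1' : T1 -> E) (f2 f2' : T2 -> E) :
  same_law P1 f1 P2 f2 -> f1 =1 f1' -> f2 =1 f2' -> same_law P1 f1' P2 f2'.
Proof. by move=> h /funext <- /funext <-. Qed.

Lemma same_law_cst (R : realType) d1 d2 d (T1 : measurableType d1)
  (T2 : measurableType d2) (E : measurableType d) (P1 : probability T1 R)
  (P2 : probability T2 R) (e : E) : same_law P1 (cst e) P2 (cst e).
Proof.
by move=> B mB; rewrite !preimage_cst; case: ifP; rewrite ?probability_setT ?measure0.
Qed.

Section induction.
Variables (R : realType) (N : nat) (X Y : 'I_N -> completePseudoMetricType R).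
Hypotheses (HX_ : forall t, polish (X t)) (HY_ : forall t, polish (Y t)).
Variables (mu : probability (PiM X) R) (nu : probability (PiM Y) R).
Variable pi : probability (PiM X * PiM Y)%type R.
Hypothesis cXY : causal X Y mu pi.
Hypothesis cYX : causal Y X nu (fun C : set (PiM Y * PiM X) =>
               pi ((fun p : PiM X * PiM Y => (p.2, p.1)) @^-1` C)).

Local Notation I := (I01M R).
Local Notation lam := (lam R).
Local Notation PX := (hatP mu).
Local Notation PY := (hatP nu).

(* [T] and [S] represent mutually inverse maps between the histories up to time
   [t], a history being a path reset to the base point from time [t] on. *)
Record stage (t : nat) (T : hatS X -> hatS Y) (S : hatS Y -> hatS X) : Prop := Stage {
  stage_mT : measurable_fun setT T;
  stage_mS : measurable_fun setT S;
  stage_Ttr : forall a, T (trH t a) = T a;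
  stage_Str : forall b, S (trH t b) = S b;
  stage_ST : forall a, S (T a) = trH t a;
  stage_TS : forall b, T (S b) = trH t b;
  stage_adT : adapted X Y T;
  stage_adS : adapted Y X S;
  stage_law : same_law PX T PY (trH t);
  stage_pi : same_law PX (fun a => (trX t a.1, (T a).1))
               pi (fun p => (trX t p.1, trX t p.2)) }.

Let mswap : measurable_fun setT (fun p : PiM X * PiM Y => (p.2, p.1)).
Proof. by mfun. Qed.

Let piS : probability (PiM Y * PiM X)%type R := law pi mswap.

Section step.
Variables (t : 'I_N) (T : hatS X -> hatS Y) (S : hatS Y -> hatS X).
Hypothesis st : stage t T S.

Let mT := stage_mT st.
Let mS := stage_mS st.
Let Ttr := stage_Ttr st.
Let Str := stage_Str st.
Let ST := stage_ST st.
Let TS := stage_TS st.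

Let TtrH a : trH t (T a) = T a. Proof. by rewrite -TS ST Ttr. Qed.
Let StrH b : trH t (S b) = S b. Proof. by rewrite -ST TS Str. Qed.
Let TtrX a : trX t (T a).1 = (T a).1. Proof. exact: (f_equal fst (TtrH a)). Qed.

Let mtX : measurable_fun setT (@trX R N X t) := @measurable_trX R N X t.
Let mtY : measurable_fun setT (@trX R N Y t) := @measurable_trX R N Y t.
Let mtX' : measurable_fun setT (@trX R N X t.+1) := @measurable_trX R N X t.+1.
Let mtHX : measurable_fun setT (@trH R N X t) := @measurable_trH R N X t.
Let mtHY : measurable_fun setT (@trH R N Y t) := @measurable_trH R N Y t.
Let mcX : measurable_fun setT (fun x : PiM X => x t : BM X t) := @measurable_coordX R N X t.
Let mcY : measurable_fun setT (fun x : PiM Y => x t : BM Y t) := @measurable_coordX R N Y t.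
Let mcU : measurable_fun setT (fun u : UM R N => u t : I) := @measurable_coordU R N t.

Let piX : same_law PX (fun a => (a.1, (T a).1)) pi (fun p => (p.1, trX t p.2)).
Proof. exact: (causal_law cXY (ltn_ord t) mT Ttr (stage_pi st)). Qed.

(** The same argument for [S] and the reversed coupling. Its hypothesis follows from [stage_pi] by
    transporting along [T], as [S (T a)] is the truncation of [a]. *)
Let piY : same_law PY (fun b => (b.1, (S b).1)) piS (fun p => (p.1, trX t p.2)).
Proof.
apply: (causal_law (pi := piS) cYX (ltn_ord t) mS Str).
have m1 : measurable_fun setT (fun b : hatS Y => (trX t b.1, (S b).1)) by mfun.
have h1 := same_law_sym (same_law_comp m1 (stage_law st)).
have m2 : measurable_fun setT (fun z : PiM X * PiM Y => (z.2, z.1)) by mfun.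
have h2 := same_law_comp m2 (stage_pi st).
suff h : same_law PY (fun b => (trX t b.1, (S b).1)) pi (fun p => (trX t p.2, trX t p.1)).
  by move=> B mB; exact: (h B mB).
apply: same_law_trans _ h2; apply: (same_law_eqfun h1) => [b|a] /=.
  by rewrite trX_tr// Str.
by rewrite TtrX ST.
Qed.

Let y0 (q : PiM X * PiM Y * I -> BM Y t) (p1 : I -> I) (a : hatS X) : BM Y t :=
  q ((trX t.+1 a.1, (T a).1), p1 (a.2 t)).

Section randomized.
Variables (p1 p2 : I -> I).
Hypotheses (mp1 : measurable_fun setT p1) (mp2 : measurable_fun setT p2).
Hypothesis p12 : same_law lam (fun s => (p1 s, p2 s)) (pprod lam lam) id.
Variable q : PiM X * PiM Y * I -> BM Y t.
Hypothesis mq : measurable_fun setT q.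
Hypothesis q_law : same_law (pprod pi lam)
  (fun p => ((trX t.+1 p.1.1, trX t p.1.2), q ((trX t.+1 p.1.1, trX t p.1.2), p.2)))
  pi (fun p => ((trX t.+1 p.1, trX t p.2), p.2 t : BM Y t)).
Variable xi : PiM X * I -> BM X t.
Hypothesis mxi : measurable_fun setT xi.
Hypothesis xi_law : same_law (pprod mu lam) (fun p => (trX t p.1, xi (trX t p.1, p.2)))
  mu (fun x => (trX t x, x t : BM X t)).
Variable ze : PiM Y * I -> BM Y t.
Hypothesis mze : measurable_fun setT ze.
Hypothesis ze_law : same_law (pprod nu lam) (fun p => (trX t p.1, ze (trX t p.1, p.2)))
  nu (fun x => (trX t x, x t : BM Y t)).

Let y : hatS X -> BM Y t := y0 q p1.

Let mxt : measurable_fun setT (fun a : hatS X => a.1 t : BM X t).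
Proof. exact: (measurableT_comp mcX (@measurable_fst _ _ (PiM X) (UM R N))). Qed.

Let mut : measurable_fun setT (fun a : hatS X => a.2 t : I).
Proof. exact: (measurableT_comp mcU (@measurable_snd _ _ (PiM X) (UM R N))). Qed.

Let myt : measurable_fun setT (fun b : hatS Y => b.1 t : BM Y t).
Proof. exact: (measurableT_comp mcY (@measurable_fst _ _ (PiM Y) (UM R N))). Qed.

Let my : measurable_fun setT y.
Proof. by rewrite /y /y0; mfun. Qed.

Let msetX : measurable_fun setT (fun p : PiM X * BM X t => setX p.1 p.2) :=
  @measurable_setX R N X t.

Let T_upd x u v : T (x, updI u t v) = T (x, u).
Proof. by rewrite -Ttr -[RHS]Ttr /trH /= trU_upd. Qed.

Let p1_law : same_law lam p1 lam id.
Proof.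
apply: same_law_trans (same_law_fst lam lam).
exact: (same_law_comp measurable_fst p12).
Qed.

Let c (a : hatS X) := (trX t.+1 a.1, (T a).1).

Let mc : measurable_fun setT c. Proof. by rewrite /c; mfun. Qed.

(** [p1 (a.2 t)] is replaced by a fresh uniform variable, then the law of [c] by that of the
    histories under [pi] ([piX]); what remains is [q_law]. *)
Let y_pi : same_law PX (fun a => (c a, y a))
  pi (fun p => ((trX t.+1 p.1, trX t p.2), p.2 t : BM Y t)).
Proof.
have mpi : measurable_fun setT (fun p : PiM X * PiM Y => (trX t.+1 p.1, trX t p.2)).
  by mfun.
have i1 : same_law PX (fun a => (c a, a.2 t : I)) (pprod PX lam) (fun p => (c p.1, p.2)).
  by apply: hatP_indep => // x u v; rewrite /c T_upd.
have i2 := same_law_noise_r PX mp1 (@measurable_id _ I setT) p1_law.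
have m3 : measurable_fun setT (fun z : PiM X * PiM Y => (trX t.+1 z.1, z.2)) by mfun.
have i4 := same_law_noise lam mc mpi (same_law_comp m3 piX).
have g1 : measurable_fun setT (fun z : PiM X * PiM Y * I => (z.1, q (z.1, p1 z.2))).
  by mfun.
have g2 : measurable_fun setT (fun z : hatS X * I => (c z.1, q (c z.1, z.2))).
  by mfun.
have g3 : measurable_fun setT (fun z : PiM X * PiM Y * I => (z.1, q (z.1, z.2))).
  by mfun.
apply: same_law_trans (same_law_comp g1 i1) _.
apply: same_law_trans (same_law_comp g2 i2) _.
apply: same_law_trans (same_law_comp g3 i4) _.
exact: q_law.
Qed.

Let phi (a : hatS X) := (trX t a.1, (T a).1).
(** Two ways to draw the new [Y]-coordinate from the path histories: [t1] first draws [x_t] given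
    the [X]-history and then applies [q], while [t2] uses the [Y]-history alone. *)
Let t1 (z : (PiM X * PiM Y) * (I * I)) : BM Y t :=
  q ((setX z.1.1 (xi (z.1.1, z.2.1)), z.1.2), p1 z.2.2).
Let t2 (z : (PiM X * PiM Y) * I) : BM Y t := ze (z.1.2, z.2).

Let mphi : measurable_fun setT phi. Proof. by rewrite /phi; mfun. Qed.

Let mset d (A : measurableType d) (f : A -> PiM X) (g : A -> BM X t) :
  measurable_fun setT f -> measurable_fun setT g ->
  measurable_fun setT (fun a => setX (f a) (g a)).
Proof. by move=> mf mg; exact: (measurableT_comp msetX (measurable_fun_pair mf mg)). Qed.

Let mt1 : measurable_fun setT t1.
Proof.
rewrite /t1; apply: (measurableT_comp mq); apply: measurable_fun_pair; last by mfun.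
by apply: measurable_fun_pair; [apply: mset; mfun|mfun].
Qed.

Let mt2 : measurable_fun setT t2. Proof. by rewrite /t2; mfun. Qed.

Definition step_q (z : hatS X * BM X t * I) : BM Y t :=
  q ((setX z.1.1.1 z.1.2, (T z.1.1).1), z.2).

Lemma measurable_step_q : measurable_fun setT step_q.
Proof.
rewrite /step_q; apply: (measurableT_comp mq); apply: measurable_fun_pair; last by mfun.
by apply: measurable_fun_pair; [apply: mset; mfun|mfun].
Qed.

Lemma step_qE a : step_q ((trH t a, a.1 t : BM X t), p1 (a.2 t)) = y a.
Proof. by rewrite /step_q /y /y0 /= setX_tr setX_id Ttr. Qed.

Lemma step_indep : same_law PX (fun a => ((trH t a, a.1 t : BM X t), a.2 t : I))
  (pprod PX lam) (fun p => ((trH t p.1, p.1.1 t : BM X t), p.2)).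
Proof.
apply: (@hatP_indep _ _ _ mu t _ _ (fun a => (trH t a, a.1 t : BM X t))); first by mfun.
by move=> x u v; rewrite /trH /= trU_upd.
Qed.

Let y_noise : same_law PX (fun a => (trH t a, y a))
  (pprod PX (pprod lam lam)) (fun p => (trH t p.1, t1 (phi p.1, p.2))).
Proof.
have m1 : measurable_fun setT (fun a : hatS X => (trH t a, a.1 t : BM X t)) by mfun.
have m2 : measurable_fun setT (fun p : hatS X * I => (trH t p.1, xi (trX t p.1.1, p.2))).
  by mfun.
have j2 := same_law_noise lam m1 m2 (hatP_randomization mxi xi_law).
have m3 : measurable_fun setT (fun p : hatS X * (I * I) =>
    ((trH t p.1, xi (trX t p.1.1, p.2.1)), p.2.2)) by mfun.
have j3 := same_law_comp m3 (pprod_assoc PX lam lam).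
have msq := measurable_step_q.
have g : measurable_fun setT (fun z : hatS X * BM X t * I =>
    (z.1.1, step_q (z.1, p1 z.2))) by mfun.
have j := same_law_trans (same_law_trans step_indep j2) j3.
apply: (same_law_eqfun (same_law_comp g j)) => [a|p] /=; first by rewrite step_qE.
by rewrite /t1 /step_q /phi /= Ttr.
Qed.

Let y_pi' : same_law PX (fun a => (phi a, y a))
  pi (fun p => ((trX t p.1, trX t p.2), p.2 t : BM Y t)).
Proof.
have g : measurable_fun setT (fun z : PiM X * PiM Y * BM Y t =>
  ((trX t z.1.1, z.1.2), z.2)) by mfun.
apply: (same_law_eqfun (same_law_comp g y_pi)) => p /=.
  by rewrite /c /phi /= trX_tr.
by rewrite trX_tr.
Qed.

Let ze_noise := hatP_randomization mze ze_law.

Let I1_noise : same_law (pprod PX lam) (fun p => (T p.1, p.2))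
  (pprod PY lam) (fun p => (trH t p.1, p.2)) :=
  same_law_noise lam mT mtHY (stage_law st).

(** This is where causality from [Y] to [X] enters: by [piY], the [X]-history obtained from [S] and
    the whole [Y]-path have their joint law under [pi]. *)
Let ze_pi : same_law (pprod PX lam) (fun p => (phi p.1, t2 (phi p.1, p.2)))
  pi (fun p => ((trX t p.1, trX t p.2), p.2 t : BM Y t)).
Proof.
have g1 : measurable_fun setT (fun z : hatS Y * I =>
  (((S z.1).1, trX t z.1.1), ze (trX t z.1.1, z.2))) by mfun.
have g2 : measurable_fun setT (fun z : hatS Y * BM Y t =>
  (((S z.1).1, trX t z.1.1), z.2)) by mfun.
have g3 : measurable_fun setT (fun z : PiM Y * PiM X =>
  ((z.2, trX t z.1), z.1 t : BM Y t)).
  mfun; exact: (measurableT_comp mcY (@measurable_fst _ _ (PiM Y) (PiM X))).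
have h1 : same_law (pprod PX lam) (fun p => (phi p.1, t2 (phi p.1, p.2)))
    (pprod PY lam) (fun p => (((S p.1).1, trX t p.1.1), ze (trX t p.1.1, p.2))).
  apply: (same_law_eqfun (same_law_comp g1 I1_noise)) => p /=.
    by rewrite /t2 /phi /= ST TtrX.
  by rewrite Str trX_tr.
have h2 : same_law PY (fun b => (((S b).1, trX t b.1), b.1 t : BM Y t))
    (pprod PY lam) (fun p => (((S p.1).1, trX t p.1.1), ze (trX t p.1.1, p.2))).
  apply: (same_law_eqfun (same_law_comp g2 ze_noise)) => p /=;
  by rewrite Str trX_tr.
apply: same_law_trans h1 _; apply: same_law_trans (same_law_sym h2) _.
have h3 := same_law_comp g3 piY.
by move=> B mB; exact: (h3 B mB).
Qed.

(* The conditional law of the new coordinate given the whole enlarged history only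
   depends on the [Y]-history: compare the two noise representations [t1], [t2]. *)
Lemma step_law : same_law PX (fun a => (trH t a, y a)) PY (fun b => (S b, b.1 t : BM Y t)).
Proof.
have g0 : measurable_fun setT (fun z : hatS X * BM Y t => (phi z.1, z.2)) by mfun.
have K1 : same_law PX (fun a => (phi a, y a))
    (pprod PX (pprod lam lam)) (fun p => (phi p.1, t1 (phi p.1, p.2))).
  apply: (same_law_eqfun (same_law_comp g0 y_noise)) => p /=;
  by rewrite /phi /= trX_tr// Ttr.
have K := same_law_trans (same_law_trans (same_law_sym K1) y_pi') (same_law_sym ze_pi).
have L := law_transfer mphi mt1 mt2 K.
have g1 : measurable_fun setT (fun z : hatS X * BM Y t => (trH t z.1, z.2)) by mfun.
have g2 : measurable_fun setT (fun z : hatS Y * I => (S z.1, ze (z.1.1, z.2))) by mfun.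
have g3 : measurable_fun setT (fun z : hatS Y * BM Y t => (S z.1, z.2)) by mfun.
apply: same_law_trans y_noise _.
apply: same_law_trans (same_law_comp g1 L) _.
apply: (@same_law_trans _ _ _ _ _ _ _ _ _ _ (pprod PY lam) _ _
  (fun p => (S p.1, ze (trX t p.1.1, p.2)))).
  apply: (same_law_eqfun (same_law_comp g2 I1_noise)) => p /=; last by rewrite Str.
  by rewrite ST /t2.
apply: same_law_sym.
by apply: (same_law_eqfun (same_law_comp g3 ze_noise)) => p /=; rewrite Str.
Qed.

Lemma step_pi : same_law PX (fun a => ((trX t.+1 a.1, (T a).1), y a))
  pi (fun p => ((trX t.+1 p.1, trX t p.2), p.2 t : BM Y t)).
Proof. exact: y_pi. Qed.

End randomized.
End step.

Lemma stage_step (t : 'I_N) T S : stage t T S -> exists T' S', stage t.+1 T' S'.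
Proof.
move=> st; have [mT mS Ttr Str ST TS adT adS law1 _] := st.
have [p1 [p2 [mp1 mp2 p12]]] := noise_splitting R.
have bX := polish_bitcoded (HX_ t); have bY := polish_bitcoded (HY_ t).
have sX := bitcoded_standard bX; have sY := bitcoded_standard bY.
have mtX : measurable_fun setT (@trX R N X t) := @measurable_trX R N X t.
have mtY : measurable_fun setT (@trX R N Y t) := @measurable_trX R N Y t.
have mtX' : measurable_fun setT (@trX R N X t.+1) := @measurable_trX R N X t.+1.
have mtH : measurable_fun setT (@trH R N X t) := @measurable_trH R N X t.
have mtY' : measurable_fun setT (@trH R N Y t.+1) := @measurable_trH R N Y t.+1.
have mcX : measurable_fun setT (fun x : PiM X => x t : BM X t) := @measurable_coordX R N X t.
have mcY : measurable_fun setT (fun x : PiM Y => x t : BM Y t) := @measurable_coordX R N Y t.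
have mcHX : measurable_fun setT (@coordH R N X t) := @measurable_coordH R N X t.
have mcHY : measurable_fun setT (@coordH R N Y t) := @measurable_coordH R N Y t.
have mxt : measurable_fun setT (fun a : hatS X => a.1 t : BM X t).
  exact: (measurableT_comp measurable_fst mcHX).
have mut : measurable_fun setT (fun a : hatS X => a.2 t : I).
  exact: (measurableT_comp measurable_snd mcHX).
have ma : measurable_fun setT (fun p : PiM X * PiM Y => (trX t.+1 p.1, trX t p.2)) by mfun.
have me : measurable_fun setT (fun p : PiM X * PiM Y => p.2 t : BM Y t).
  exact: (measurableT_comp mcY (@measurable_snd _ _ (PiM X) (PiM Y))).
have [q [mq ql]] := randomization pi ma me sY.
have [xi [mxi xil]] := randomization mu mtX mcX sX.
have [ze [mze zel]] := randomization nu mtY mcY sY.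
have msq := measurable_step_q st mq.
have [phi [psi [mphi mpsi phiK psiK [philaw [D [mD D0 DE]]]]]] :=
  one_step bX bY mtH mxt mut (@step_indep t) mp1 mp2 p12 msq.
have slaw := step_law st mp1 p12 mq ql mxi xil mze zel.
have spi := step_pi st mp1 p12 mq ql.
(* [phi] receives the truncated history and the time-[t] coordinates only, which yields adaptedness
   and independence of later times. *)
pose T' a := setH (T a) (phi (trH t a, coordH t a)).
pose S' b := setH (S b) (psi (S b, coordH t b)).
have msH : measurable_fun setT (fun p : hatS Y * (BM Y t * I) => setH p.1 p.2).
  exact: measurable_setH.
have mhx : measurable_fun setT (fun a => phi (trH t a, coordH t a)) by mfun.
have mT' : measurable_fun setT T'.
  exact: (measurableT_comp msH (measurable_fun_pair mT mhx)).
have mS' : measurable_fun setT S'.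
  have mhy : measurable_fun setT (fun b => psi (S b, coordH t b)) by mfun.
  exact: (measurableT_comp (@measurable_setH R N X t) (measurable_fun_pair mS mhy)).
have TT1 a : T (trH t.+1 a) = T a by rewrite -Ttr trH_tr// Ttr.
have SS1 b : S (trH t.+1 b) = S b by rewrite -Str trH_tr// Str.
have StrH b : trH t (S b) = S b by rewrite -ST TS Str.
have agree (Z : 'I_N -> completePseudoMetricType R) (a a' : hatS Z) :
    (forall s : 'I_N, (s <= t)%N -> a.1 s = a'.1 s /\ a.2 s = a'.2 s) ->
    trH t a = trH t a' /\ coordH t a = coordH t a'.
  move=> aa'; split; last by rewrite /coordH; have [-> ->] := aa' t (leqnn t).
  congr (_, _).
    apply: functional_extensionality_dep => s; rewrite /trX; case: ltnP => // st'.
    by have [-> _] := aa' s (ltnW st').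
  apply/funext => s; rewrite /trU; case: ltnP => // st'.
  by have [_ ->] := aa' s (ltnW st').
exists T', S'; split => //.
- by move=> a; rewrite /T' TT1 trH_tr// coordH_tr.
- by move=> b; rewrite /S' SS1 coordH_tr.
- move=> a; rewrite /S' coordH_set.
  have -> : S (T' a) = trH t a by rewrite -Str trH_set Str ST.
  by rewrite phiK setH_tr.
- move=> b; rewrite /T' coordH_set.
  have -> : trH t (S' b) = S b by rewrite trH_set StrH.
  have -> : T (S' b) = trH t b by rewrite -Ttr trH_set Ttr TS.
  by rewrite psiK setH_tr.
- move=> s a a' aa'; rewrite /T' /setH /= /setX /updI.
  have [ts|ts] := eqVneq t s.
    by subst s; have [-> ->] := agree X a a' aa'; rewrite !dfwithin eqxx.
  have [e1 e2] := adT s a a' aa'.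
  rewrite !dfwithout// e1 e2; split => //.
  by have -> : (s == t :> nat) = false by rewrite val_eqE eq_sym (negbTE ts).
- move=> s b b' bb'; rewrite /S' /setH /= /setX /updI.
  have [ts|ts] := eqVneq t s.
    subst s; have [e1 ->] := agree Y b b' bb'.
    by rewrite -(Str b) e1 Str.
  have [e1 e2] := adS s b b' bb'.
  rewrite !dfwithout// e1 e2; split => //.
  by have -> : (s == t :> nat) = false by rewrite val_eqE eq_sym (negbTE ts).
- have g1 : measurable_fun setT (fun z : hatS X * (BM Y t * I) => setH (T z.1) z.2).
    have m : measurable_fun setT (fun z : hatS X * (BM Y t * I) => (T z.1, z.2)) by mfun.
    exact: (measurableT_comp msH m).
  have h1 := same_law_comp g1 philaw.
  have g2 : measurable_fun setT (fun z : hatS X * BM Y t * I => setH (T z.1.1) (z.1.2, z.2)).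
    have m : measurable_fun setT (fun z : hatS X * BM Y t * I => (T z.1.1, (z.1.2, z.2))).
      by mfun.
    exact: (measurableT_comp msH m).
  have mfy : measurable_fun setT (fun a => (trH t a,
      q ((trX t.+1 a.1, (T a).1), p1 (a.2 t)))) by mfun.
  have mfb : measurable_fun setT (fun b => (S b, b.1 t : BM Y t)).
    by apply: measurable_fun_pair => //; exact: (measurableT_comp measurable_fst mcHY).
  have h2 := same_law_comp g2 (same_law_noise lam mfy mfb slaw).
  (* Overwriting the time-[t] noise by the fresh uniform variable from [one_step] leaves the law of
     the enlarged [Y]-history unchanged. *)
  have h3 := same_law_comp mtY' (hatP_resample nu t).
  apply: (@same_law_trans _ _ _ _ _ _ _ _ _ _ (pprod PX lam) _ _
    (fun p => setH (T p.1) (q ((trX t.+1 p.1.1, (T p.1).1), p1 (p.1.2 t)), p.2))).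
    apply: (same_law_eqfun h1) => p /=; first by rewrite Ttr.
    by rewrite /= (step_qE st) Ttr.
  apply: (@same_law_trans _ _ _ _ _ _ _ _ _ _ (pprod PY lam) _ _
    (fun p => setH (trH t p.1) (p.1.1 t, p.2))).
    by apply: (same_law_eqfun h2) => p /=; [rewrite Ttr|rewrite TS].
  apply: (same_law_eqfun h3) => p //=.
  by rewrite /setH /trH /= setX_tr setX_id updI_tr.
- have g1 : measurable_fun setT (fun z : PiM X * PiM Y * BM Y t => (z.1.1, setX z.1.2 z.2)).
    apply: measurable_fun_pair; first by mfun.
    have m : measurable_fun setT (fun z : PiM X * PiM Y * BM Y t => (z.1.2, z.2)) by mfun.
    exact: (measurableT_comp (@measurable_setX R N Y t) m).
  have h1 := same_law_comp g1 spi.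
  apply: (@same_law_trans _ _ _ _ _ _ _ _ _ _ PX _ _
    (fun a => (trX t.+1 a.1, setX (T a).1 (q ((trX t.+1 a.1, (T a).1), p1 (a.2 t)))))).
    (* The exact bijection produces the intended [Y]-coordinate only on the full set [D], which is
       enough for laws. *)
    apply: (same_law_ae _ _ mD D0).
    - by mfun.
    - apply: measurable_fun_pair; first by mfun.
      have m : measurable_fun setT (fun a : hatS X =>
        ((T a).1, q ((trX t.+1 a.1, (T a).1), p1 (a.2 t)))) by mfun.
      exact: (measurableT_comp (@measurable_setX R N Y t) m).
    - by move=> a /set_mem /DE; rewrite (step_qE st) /T' /setH /= => ->.
  apply: (same_law_eqfun h1) => p //=.
  by rewrite setX_tr setX_id.
Qed.

Lemma stage0 : exists T S, stage 0 T S.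
Proof.
pose a0 : hatS X := trH 0 point; pose b0 : hatS Y := trH 0 point.
have aE a : trH 0 a = a0 by rewrite /a0 /trH (trX0 a.1 (point : hatS X).1) (trU0 a.2 (point : hatS X).2).
have bE b : trH 0 b = b0 by rewrite /b0 /trH (trX0 b.1 (point : hatS Y).1) (trU0 b.2 (point : hatS Y).2).
exists (cst b0), (cst a0); split => //.
- by apply: (same_law_eqfun (@same_law_cst _ _ _ _ _ _ _ PX PY b0)) => // b; rewrite bE.
- apply: (same_law_eqfun (@same_law_cst _ _ _ _ _ _ _ PX pi (a0.1, b0.1))) => p //=.
Qed.

Lemma stageN : exists T S, stage N T S.
Proof.
suff H t : (t <= N)%N -> exists T S, stage t T S by exact: H.
elim: t => [_|t IH tN]; first exact: stage0.
have [T [S st]] := IH (ltnW tN).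
exact: (@stage_step (Ordinal tN) T S st).
Qed.

End induction.

(** * From biadapted maps to bicausal couplings *)

Section noise_kernel.
Context (R : realType) d d' dW (A : measurableType d) (E : measurableType d')
  (W : measurableType dW) (Q : probability W R) (f : A * W -> E).
Hypothesis mf : measurable_fun setT f.

Let mfa a : measurable_fun setT (fun w => f (a, w)).
Proof. exact: (measurableT_comp mf (pair1_measurable a)). Qed.

Definition noise_kernel (a : A) : {measure set E -> \bar R} :=
  law Q (mfa a).

Let measurable_noise_kernel B : measurable B ->
  measurable_fun setT (noise_kernel ^~ B).
Proof.
by move=> mB; exact: (measurable_fun_section Q (measurable_preimageT mf mB)).
Qed.

HB.instance Definition _ :=
  isKernel.Build _ _ _ _ R noise_kernel measurable_noise_kernel.

Let noise_kernel_setT a : noise_kernel a setT = 1%E.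
Proof. exact: probability_setT (law Q (mfa a)). Qed.

HB.instance Definition _ :=
  Kernel_isProbability.Build _ _ _ _ R noise_kernel noise_kernel_setT.

End noise_kernel.

Section adapted_causal.
Variables (R : realType) (N : nat) (X Y : 'I_N -> completePseudoMetricType R).
Variable mu : probability (PiM X) R.

Lemma hat_measurable_fun (T : hat X -> hat Y) :
  measurable_fun [set: HatM X] (T : HatM X -> HatM Y) <->
  measurable_fun setT (T : hatS X -> hatS Y).
Proof.
split=> mT _ B mB; rewrite setTI.
  apply/(@hat_measurable R N X (T @^-1` B)).
  by apply: (measurable_preimageT mT); apply/(@hat_measurable R N Y B).
apply/(@hat_measurable R N X (T @^-1` B)).
by apply: (measurable_preimageT mT); apply/(@hat_measurable R N Y B).
Qed.

Lemma adapted_causal (T : hatS X -> hatS Y) (pi : set (PiM X * PiM Y) -> \bar R) :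
  measurable_fun setT T -> adapted X Y T ->
  (forall A B, measurable A -> measurable B ->
     pi (A `*` B) = hatP mu (fst @^-1` A `&` (fun a => (T a).1) @^-1` B)) ->
  causal X Y mu pi.
Proof.
move=> mT adT piE.
have mT1 : measurable_fun setT (fun a : hatS X => (T a).1).
  exact: (measurableT_comp measurable_fst mT).
pose k : R.-pker (PiM X) ~> (PiM Y) := noise_kernel (LN R N) mT1.
exists k; split.
  move=> A B mA mB; rewrite piE// setIC [LHS]pprodE_fst//.
  exact: measurable_preimageT.
move=> t _ B FB V mV.
have [mB BE] := cyl_uptoP FB.
(* Coordinates of [T] before [t] read no coordinate from [t] on, whatever the noise is. *)
have Ttr x u : trX t (T (trX t x, u)).1 = trX t (T (x, u)).1.
  apply: functional_extensionality_dep => s; rewrite /trX; case: ltnP => // st.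
  have [|-> //] := adT s (trX t x, u) (x, u).
  by move=> s' s's; rewrite /= /trX (leq_ltn_trans s's st).
have ktr x : k (trX t x) B = k x B.
  have e x' : k x' B = LN R N [set u | B (trX t (T (x', u)).1)] by rewrite -{1}BE.
  by rewrite !e; congr (LN R N _); apply/seteqP; split => u /=; rewrite Ttr.
have mA : measurable ((fun x => k x B) @^-1` V).
  by apply: measurable_preimageT mV; exact: measurable_kernel.
(* The preimage of [V] is measurable and invariant under truncation, hence belongs to the past. *)
have := cyl_upto_trX (t := t) mA.
rewrite (_ : _ @^-1` _ = (fun x => k x B) @^-1` V)//.
by apply/seteqP; split => x /=; rewrite ktr.
Qed.

End adapted_causal.

Lemma biadapted_bicausal (R : realType) (N : nat) (X Y : 'I_N -> completePseudoMetricType R)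
  (mu : probability (PiM X) R) (nu : probability (PiM Y) R)
  (pi : probability (PiM X * PiM Y)%type R) (T : hatS X -> hatS Y) (S : hatS Y -> hatS X) :
  measurable_fun setT T -> measurable_fun setT S -> cancel T S ->
  adapted X Y T -> adapted Y X S ->
  same_law (hatP mu) T (hatP nu) id ->
  (forall C, measurable C -> pi C = hatP mu ((fun a => (a.1, (T a).1)) @^-1` C)) ->
  bicausal X Y mu nu pi.
Proof.
move=> mT mS TK adT adS lawT' piE.
have mT1 : measurable_fun setT (fun a => (T a).1).
  exact: (measurableT_comp measurable_fst mT).
have mS1 : measurable_fun setT (fun b => (S b).1).
  exact: (measurableT_comp measurable_fst mS).
have piX A B : measurable A -> measurable B ->
    pi (A `*` B) = hatP mu (fst @^-1` A `&` (fun a => (T a).1) @^-1` B).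
  by move=> mA mB; rewrite piE//; exact: measurableX.
(* The event is transported by [T] to the [Y] side, where [S] recovers the [X]-path; this represents
   the reversed coupling by an adapted map. *)
have piY A B : measurable A -> measurable B ->
    pi (A `*` B) = hatP nu (fst @^-1` B `&` (fun b => (S b).1) @^-1` A).
  move=> mA mB; rewrite piX//.
  have mD : measurable (fst @^-1` B `&` (fun b => (S b).1) @^-1` A).
    by apply: measurableI; exact: measurable_preimageT.
  rewrite -[RHS](lawT' _ mD); congr (_ _).
  by apply/seteqP; split => a /=; rewrite TK => -[].
have margX (Z : 'I_N -> completePseudoMetricType R) (rho : probability (PiM Z) R) A :
    measurable A -> hatP rho (fst @^-1` A `&` setT) = rho A.
  move=> mA; rewrite setIT; exact: (same_law_fst rho (LN R N) mA).
split; last split.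
- split => A mA; first by rewrite piX//; exact: margX.
  by rewrite piY//; exact: margX.
- exact: (adapted_causal mT adT).
- apply: (adapted_causal mS adS) => B A mB mA; rewrite -piY//.
  by congr (pi _); apply/seteqP; split => -[x y] /= [].
Qed.

Theorem theorem3p5 (R : realType) (N : nat)
  (X Y : 'I_N -> completePseudoMetricType R)
  (HX : forall t, polish (X t)) (HY : forall t, polish (Y t))
  (mu : probability (PiM X) R) (nu : probability (PiM Y) R)
  (pi : probability (PiM X * PiM Y)%type R) :
  bicausal X Y mu nu pi <->
  exists T : hat X -> hat Y,
    biadapted X Y T /\
    (* (i) T_* hat mu = hat nu *)
    (forall B : set (HatM Y), measurable B ->
       hatmeasure X mu (T @^-1` B) = hatmeasure Y nu B) /\
    (* (ii) (pr_{XxY})_* (id, T)_* hat mu = pi *)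
    (forall C : set (PiM X * PiM Y), measurable C ->
       hatmeasure X mu [set a : hat X | C (a.1, (T a).1)] = pi C).
Proof.
split.
  move=> [_ [cXY cYX]].
  have [T [S [mT mS _ _ ST TS adT adS lawT lawpi]]] := stageN HX HY cXY cYX.
  exists T; split; first split.
  - exact/hat_measurable_fun.
  - exists S; split; first by move=> a; rewrite ST trH_N.
    split; first by move=> b; rewrite TS trH_N.
    by split; first exact/hat_measurable_fun.
  split.
    move=> B /hat_measurable mB.
    rewrite (hatmeasureE mu (measurable_preimageT mT mB)) (hatmeasureE nu mB) lawT//.
    by congr (_ _); apply/seteqP; split => b /=; rewrite trH_N.
  move=> C mC.
  have mTC : measurable_fun setT (fun a => (a.1, (T a).1)).
    by apply: measurable_fun_pair => //; exact: (measurableT_comp measurable_fst mT).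
  rewrite (hatmeasureE mu (measurable_preimageT mTC mC)).
  transitivity (hatP mu ((fun a => (trX N a.1, (T a).1)) @^-1` C)).
    by congr (_ _); apply/seteqP; split => a /=; rewrite trX_N.
  rewrite lawpi//.
  by congr (_ _); apply/seteqP; split => -[x y] /=; rewrite !trX_N.
move=> [T [[/hat_measurable_fun mT [S [TK [_ [/hat_measurable_fun mS [adT adS]]]]]] [lawT lawpi]]].
apply: (biadapted_bicausal mT mS TK adT adS) => [B mB|C mC].
  rewrite -(hatmeasureE mu (measurable_preimageT mT mB)).
  by rewrite lawT ?hatmeasureE//; exact/hat_measurable.
have mTC : measurable_fun setT (fun a : hatS X => (a.1, (T a : hatS Y).1)).
  by apply: measurable_fun_pair => //; exact: (measurableT_comp measurable_fst mT).
by rewrite -lawpi// (hatmeasureE mu (measurable_preimageT mTC mC)).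
Qed.
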